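(* Let $\mathfrak{A}$ be a unital $C^*$-algebra and $a\in\mathfrak{A}$ a nonzero positive element. Then: (i) If the algebra $\mathfrak{A}_a$ is commutative, then $n_a(\mathfrak{A})=1$. (ii) If $\mathfrak{A}$ is not commutative and $a$ is invertible, then $n_a(\mathfrak{A})=\frac12$. (iii) If there exists $x\in\mathfrak{A}_a$ such that $ax\neq 0$ and $ax^2=0$, then $n_a(\mathfrak{A})=\frac12$.
   Context: $\mathcal{S}(\mathfrak{A})$ is the set of states of $\mathfrak{A}$ and $\mathcal{S}_a(\mathfrak{A})=\{f/f(a): f\in\mathcal{S}(\mathfrak{A}),\ f(a)\ne 0\}$. For $x\in\mathfrak{A}$, $\|x\|_a=\sup\{\sqrt{f(x^*ax)}: f\in\mathcal{S}_a(\mathfrak{A})\}\in[0,\infty]$, and the $a$-numerical radius is $v_a(x)=\sup\{|f(ax)|: f\in\mathcal{S}_a(\mathfrak{A})\}$. An element $x^{\sharp_a}\in\mathfrak{A}$ is an $a$-adjoint of $x$ if $ax^{\sharp_a}=x^*a$; $\mathfrak{A}_a$ is the set of all elements of $\mathfrak{A}$ admitting an $a$-adjoint (a subalgebra of $\mathfrak{A}$ on which $\|\cdot\|_a$ is a finite semi-norm). The $a$-numerical index of $\mathfrak{A}$ is $n_a(\mathfrak{A})=\inf\{v_a(x): x\in\mathfrak{A}_a,\ \|x\|_a=1\}$. *)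

(* Defs.v *)
From HB Require Import structures.
From mathcomp Require Import all_boot all_order all_algebra.
From mathcomp Require Import complex.
From mathcomp Require Import all_classical all_reals ereal.

Set Implicit Arguments.
Unset Strict Implicit.
Unset Printing Implicit Defensive.

Import Order.TTheory GRing.Theory Num.Theory.

Local Open Scope classical_set_scope.
Local Open Scope ring_scope.

(* Unital C*-algebras over R[i].  Hierarchy Builder rejects a structure
   joining algType and completeNormedModType (numDomainType, declared upstream,
   already is a join of rings and normed Z-modules), hence the explicit
   norm and completeness fields. *)
Record cstarAlgType (R : realType) := CStarAlgType {
  cstar_alg :> algType R[i];
  cnorm : cstar_alg -> R;
  star : cstar_alg -> cstar_alg;
  cnorm_eq0 : forall x, cnorm x = 0 -> x = 0;
  cnormZ : forall c x, cnorm (c *: x) = Normc.normc c * cnorm x;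
  cnormD : forall x y, cnorm (x + y) <= cnorm x + cnorm y;
  cnormM : forall x y, cnorm (x * y) <= cnorm x * cnorm y;
  cnorm_complete : forall u : nat -> cstar_alg,
    (forall e : R, 0 < e -> exists N : nat, forall m n : nat,
       (N <= m)%N -> (N <= n)%N -> cnorm (u m - u n) < e) ->
    exists l : cstar_alg, forall e : R, 0 < e -> exists N : nat,
      forall n : nat, (N <= n)%N -> cnorm (u n - l) < e;
  starK : forall x, star (star x) = x;
  starD : forall x y, star (x + y) = star x + star y;
  starZ : forall c x, star (c *: x) = Num.conj c *: star x;
  starM : forall x y, star (x * y) = star y * star x;
  cnorm_starM : forall x, cnorm (star x * x) = cnorm x ^+ 2
}.

Definition invertible (R : realType) (A : cstarAlgType R) (x : A) : Prop :=
  exists y : A, x * y = 1 /\ y * x = 1.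

Definition spectrum (R : realType) (A : cstarAlgType R) (x : A) : set R[i] :=
  [set l | ~ invertible (x - l%:A)].

(* In R[i], [0 <= z] means that z is real and nonnegative. *)
Definition is_positive (R : realType) (A : cstarAlgType R) (x : A) : Prop :=
  star x = x /\ (forall l, spectrum x l -> 0 <= l).

(* Boundedness need not be required: positivity implies it, with norm f 1. *)
Definition states (R : realType) (A : cstarAlgType R) : set (A -> R[i]) :=
  [set f | [/\ scalar f, (forall x, 0 <= f (star x * x)) & f 1 = 1]].
Arguments states {R} A.

Definition states_at (R : realType) (A : cstarAlgType R) (a : A) :
    set (A -> R[i]) :=
  [set (fun x => f x / f a) | f in [set f | states A f /\ f a != 0]].

(* For a positive, f (star x * a * x) is real and nonnegative, so that taking
   its real part only changes the type. *)
Definition norm_at (R : realType) (A : cstarAlgType R) (a x : A) : \bar R :=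
  ereal_sup [set (Num.sqrt (complex.Re (f (star x * a * x))))%:E
            | f in states_at a].

Definition num_radius_at (R : realType) (A : cstarAlgType R) (a x : A) :
    \bar R :=
  ereal_sup [set (Normc.normc (f (a * x)))%:E | f in states_at a].

Definition adjointable (R : realType) (A : cstarAlgType R) (a : A) : set A :=
  [set x | exists y : A, a * y = star x * a].

Definition num_index_at (R : realType) (A : cstarAlgType R) (a : A) : \bar R :=
  ereal_inf [set num_radius_at a x
            | x in [set x | adjointable a x /\ norm_at a x = 1%:E]].

(* Main.v *)
(* Each [f] in [states_at a] makes the algebra a pre-Hilbert space for the form
   [(u, w) |-> f (w^* a u)], on which an [a]-adjointable [x] acts by left
   multiplication as a bounded operator with adjoint [x^#]; since [states_at a]
   is stable under [f |-> f (u^* . u) / f (u^* a u)], [norm_at a x] and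
   [num_radius_at a x] are the operator norm and the numerical radius of the sum
   [T] of these actions.  Polarization gives [|T| <= 2 w(T)].  If [T] commutes
   with its adjoint, then [|T|^2 <= |T^2|] and [w(T^2) <= w(T)^2], and iterating
   removes the factor 2.  If [T^2 = 0], then [|T u| = |T (u - l T u)|] for all
   scalars [l], and optimizing [l] gives [2 w(T) <= |T|].  A noncommutative
   C*-algebra contains a nonzero element of square 0: otherwise the positive and
   negative parts of [b - t] annihilate each other on both sides of any [c], for
   every self-adjoint [b] and real [t], which forces [b] and [c] to commute. *)
Require Import Defs.
From HB Require Import structures.
From mathcomp Require Import all_boot all_order all_algebra.
From mathcomp Require Import complex.
From mathcomp Require Import all_classical all_reals ereal.
From mathcomp Require Import ring lra zify.

Set Implicit Arguments.
Unset Strict Implicit.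
Unset Printing Implicit Defensive.

Import Order.TTheory GRing.Theory Num.Theory.

Local Open Scope ring_scope.

(** The sum [T] is never constructed: each operator inequality is proved for one positive functional
    [f] with [f a = 1], using a hypothesis on all such functionals at its conjugates by [u]. The
    form may be degenerate, so vectors with [f (star u * a * u) = 0] are handled separately by
    Cauchy-Schwarz. The underlying theory of positive elements uses no functional calculus. A
    norm-convergent square root yields absolute values, positive parts and the positivity of
    [star x * x]; states come from maximal convex cones of self-adjoint elements. Part (ii) reduces
    to the argument for (iii), since an invertible [a] makes every element adjointable. That
    argument also needs the seminorm of an adjointable [x] to be finite, in order to normalize
    [x]. *)

Section RealSequences.
Context {R : realType}.
Implicit Types p r C : R.

(** If [p] exceeded [r], Bernoulli's inequality would push [(p / r) ^+ (2 ^ k)] above [C]. This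
    removes the constants left over after repeated squaring. *)
Lemma ler_of_pow2_growth p r C : 0 <= p -> 0 <= r ->
  (forall k, p ^+ (2 ^ k) <= C * r ^+ (2 ^ k)) -> p <= r.
Proof.
move=> p0 r0 H; rewrite leNgt; apply/negP => rp.
have [r00|rgt] := eqVneq r 0.
  by have := H 0%N; rewrite r00 expn0 !expr1 mulr0 leNgt -r00 rp.
have rpos : 0 < r by rewrite lt_def rgt.
pose q := p / r.
have q1 : 1 < q by rewrite ltr_pdivlMr ?mul1r.
have Hq k : q ^+ (2 ^ k) <= C.
  by rewrite expr_div_n ler_pdivrMr ?exprn_gt0.
have B n : 1 + (q - 1) *+ n <= q ^+ n.
  elim: n => [|n IH]; first by rewrite mulr0n addr0 expr0.
  have h0 : 0 <= (q - 1) *+ n by rewrite mulrn_wge0 // subr_ge0 ltW.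
  rewrite exprS mulrS; apply: (@le_trans _ _ (q * (1 + (q - 1) *+ n))); last first.
    by rewrite ler_pM2l //; lra.
  by nra.
have c1 : 0 <= `|C| / (q - 1) by rewrite divr_ge0 // subr_ge0 ltW.
have /= := archi_boundP c1; set k := Num.bound _ => hk.
have : C < q ^+ (2 ^ k).
  apply: lt_le_trans (B _); apply: (@lt_le_trans _ _ ((q - 1) *+ k)).
    move: hk; rewrite ltr_pdivrMr ?subr_gt0 // mulr_natl => hk.
    exact: le_lt_trans (ler_norm _) hk.
  apply: (@le_trans _ _ ((q - 1) *+ 2 ^ k)); last by rewrite lerDr.
  by apply: ler_wpMn2l; [rewrite subr_ge0 ltW|rewrite ltnW // ltn_expl].
by rewrite ltNge Hq.
Qed.

Lemma ler_of_forall_addM p r C :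
  (forall e : R, 0 < e -> e <= 1 -> p <= r + C * e) -> p <= r.
Proof.
move=> H; rewrite leNgt; apply/negP => rp.
pose K := `|C| + 1.
have K1 : C <= K by rewrite /K; apply: (le_trans (ler_norm C)); rewrite lerDl.
have K0 : 1 <= K by rewrite /K lerDr.
pose e := Num.min 1 ((p - r) / (2 * K)).
have e0 : 0 < e.
  rewrite /e lt_min ltr01 /= divr_gt0 ?subr_gt0 // mulr_gt0 //; lra.
have e1 : e <= 1 by rewrite /e ge_min lexx.
have e2 : e <= (p - r) / (2 * K) by rewrite /e ge_min lexx orbT.
have e3 : K * e <= (p - r) / 2.
  move: e2; rewrite ler_pdivlMr; last by lra.
  by move=> h; lra.
have := H e e0 e1.
have : C * e <= K * e by rewrite ler_wpM2r // ltW.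
by lra.
Qed.

Lemma monotone_bounded_cauchy (u : nat -> R) (M : R) :
  (forall n, u n <= u n.+1) -> (forall n, u n <= M) ->
  forall e, 0 < e -> exists N, forall n, (N <= n)%N -> u n - u N < e.
Proof.
move=> um uM e e0.
have hs : has_sup [set x | exists n, x = u n]%classic.
  by split; [exists (u 0%N), 0%N|exists M => _ [n ->]].
have [_ [N ->] hN] := sup_adherent e0 hs.
exists N => n _.
have : u n <= sup [set x | exists n, x = u n]%classic.
  by apply: ub_le_sup; [exact: hs.2|exists n].
by lra.
Qed.

(** Scalar majorant of the square root iteration below: it increases and is bounded, so its
    increments control a Cauchy sequence in the algebra. *)
Fixpoint sqrt_iterR (n : nat) : R :=
  if n is m.+1 then 2^-1 * (1 + sqrt_iterR m * sqrt_iterR m) else 0.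

Lemma sqrt_iterR_bounds n : 0 <= sqrt_iterR n <= 1.
Proof.
elim: n => [|n /andP[h1 h2]] /=; first by rewrite lexx ler01.
by apply/andP; split; nra.
Qed.

Lemma sqrt_iterR_mono n : sqrt_iterR n <= sqrt_iterR n.+1.
Proof.
elim: n => [|n IH]; first by rewrite /=; lra.
have /andP[h1 h2] := sqrt_iterR_bounds n.
have /andP[h3 h4] := sqrt_iterR_bounds n.+1.
by move: IH h3 h4; rewrite /=; nra.
Qed.

End RealSequences.

(** * C*-algebras and square roots *)

Section Basics.
Context {R : realType} {A : cstarAlgType R}.
Implicit Types (x y z h : A) (r : R).
Local Notation rc r := (r%:C)%C.
Local Notation sc r := (r%:C%C *: (1 : A)).

Lemma cnormZr r x : cnorm (rc r *: x) = `|r| * cnorm x.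
Proof. by rewrite cnormZ /= expr0n /= addr0 sqrtr_sqr. Qed.

Lemma cnorm0 : cnorm (0 : A) = 0.
Proof. by rewrite -(scale0r (0 : A)) (_ : 0 = rc 0) // cnormZr normr0 mul0r. Qed.

Lemma cnormN x : cnorm (- x) = cnorm x.
Proof.
by rewrite -scaleN1r (_ : - 1 = rc (-1)) ?cnormZr ?normrN1 ?mul1r // rmorphN.
Qed.

Lemma cnorm_ge0 x : 0 <= cnorm x.
Proof. by have := cnormD x (- x); rewrite subrr cnorm0 cnormN; lra. Qed.

Lemma cnormB x y : cnorm (x - y) <= cnorm x + cnorm y.
Proof. by rewrite -[cnorm y]cnormN cnormD. Qed.

Lemma cnormBC x y : cnorm (x - y) = cnorm (y - x).
Proof. by rewrite -cnormN opprB. Qed.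

Lemma star0 : star (0 : A) = 0.
Proof. by apply: (addrI (star 0)); rewrite -starD !addr0. Qed.

Lemma starN x : star (- x) = - star x.
Proof. by apply: (addrI (star x)); rewrite -starD !subrr star0. Qed.

Lemma starB x y : star (x - y) = star x - star y.
Proof. by rewrite starD starN. Qed.

Lemma star1 : star (1 : A) = 1.
Proof. by rewrite -[LHS]mulr1 -{2}(starK 1) -starM mulr1 starK. Qed.

Lemma starZr r x : star (rc r *: x) = rc r *: star x.
Proof. by rewrite starZ; congr (_ *: _); exact: conjc_real. Qed.

Lemma star_sc r : star (sc r) = sc r.
Proof. by rewrite starZr star1. Qed.

Lemma starX x n : star (x ^+ n) = star x ^+ n.
Proof. by elim: n => [|n IH]; rewrite ?expr0 ?star1 // exprS starM IH -exprSr. Qed.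

(** Cancel one factor in [cnorm z ^+ 2 = cnorm (star z * z) <= cnorm (star z) * cnorm z]. *)
Lemma cnorm_star x : cnorm (star x) = cnorm x.
Proof.
have le z : cnorm z <= cnorm (star z).
  have := cnormM (star z) z; rewrite cnorm_starM expr2.
  have [->|z0] := eqVneq (cnorm z) 0; first by rewrite cnorm_ge0.
  by rewrite ler_pM2r // lt_def z0 cnorm_ge0.
by apply/eqP; rewrite eq_le le -{2}(starK x) le.
Qed.

Lemma cnorm_sqr h : star h = h -> cnorm (h * h) = cnorm h ^+ 2.
Proof. by move=> hh; rewrite -{1}hh cnorm_starM. Qed.

Lemma cnorm1 : cnorm (1 : A) = 1.
Proof.
have := cnorm_sqr star1; rewrite mulr1 expr2 => h.
have n0 : cnorm (1 : A) != 0.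
  by apply/eqP => /cnorm_eq0 /eqP; apply/negP; exact: oner_neq0.
by apply: (mulfI n0); rewrite -h mulr1.
Qed.

Lemma cnorm_sc r : cnorm (sc r) = `|r|.
Proof. by rewrite cnormZr cnorm1 mulr1. Qed.

Lemma cnormX x n : cnorm (x ^+ n) <= cnorm x ^+ n.
Proof.
elim: n => [|n IH]; first by rewrite !expr0 cnorm1.
rewrite !exprS; apply: (le_trans (cnormM _ _)).
by rewrite ler_wpM2l ?cnorm_ge0.
Qed.

Lemma cnorm_le0 x : cnorm x <= 0 -> x = 0.
Proof. by move=> h; apply: cnorm_eq0; apply/eqP; rewrite eq_le h cnorm_ge0. Qed.

Lemma star_sqr_eq0 x : star x * x = 0 -> x = 0.
Proof.
move=> h; apply: cnorm_le0; have := cnorm_starM x.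
by rewrite h cnorm0 => /esym/eqP; rewrite expf_eq0 => /andP[_ /eqP ->].
Qed.

Lemma sa_sqr_eq0 h : star h = h -> h * h = 0 -> h = 0.
Proof. by move=> hh h0; apply: star_sqr_eq0; rewrite hh. Qed.

Lemma cnorm_sqrB x y :
  cnorm (x * x - y * y) <= (cnorm x + cnorm y) * cnorm (x - y).
Proof.
have -> : x * x - y * y = x * (x - y) + (x - y) * y.
  by rewrite mulrBr mulrBl addrA addrNK.
apply: (le_trans (cnormD _ _)).
by rewrite [leRHS]mulrDl [cnorm y * _]mulrC lerD // cnormM.
Qed.

Lemma scrD r s : sc (r + s) = sc r + sc s.
Proof. by rewrite rmorphD scalerDl. Qed.

Lemma scrB r s : sc (r - s) = sc r - sc s.
Proof. by rewrite rmorphB scalerBl. Qed.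

Lemma scr1 : sc 1 = 1.
Proof. exact: scale1r. Qed.

Lemma sc_comm r x : sc r * x = x * sc r.
Proof. by rewrite -scalerAl -scalerAr mul1r mulr1. Qed.

Lemma scM r x : sc r * x = rc r *: x.
Proof. by rewrite -scalerAl mul1r. Qed.

Lemma scr2 x : rc 2 *: x = x + x.
Proof. by rewrite (_ : 2 = 1 + 1 :> R) // rmorphD scalerDl scale1r. Qed.

(** Fixed point iteration for [1 - sqrt (1 - u)]; the iterates are polynomials in [u] with
    nonnegative coefficients. *)
Fixpoint sqrt_iter (u : A) (n : nat) : A :=
  if n is m.+1 then rc 2^-1 *: (u + sqrt_iter u m * sqrt_iter u m) else 0.

(* The fixed points [y] of the iteration satisfy [(1 - y)^2 = 1 - u]; the
   scalar iteration started from [u = 1] dominates it. *)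
Lemma sqrt_one_sub u : star u = u -> cnorm u <= 1 ->
  exists y, [/\ star y = y, cnorm y <= 1, (1 - y) * (1 - y) = 1 - u &
             forall z, z * u = u * z -> z * y = y * z].
Proof.
move=> su nu.
have half0 : 0 <= (2^-1 : R) by rewrite invr_ge0 ler0n.
have yn n : cnorm (sqrt_iter u n) <= sqrt_iterR n.
  elim: n => [|n IH] /=; first by rewrite cnorm0.
  rewrite cnormZr ger0_norm // ler_wpM2l //.
  apply: (le_trans (cnormD _ _)); apply: lerD => //.
  apply: (le_trans (cnormM _ _)); apply: ler_pM => //; exact: cnorm_ge0.
have ys n : star (sqrt_iter u n) = sqrt_iter u n.
  by elim: n => [|n IH] /=; rewrite ?star0 // starZr starD su starM IH.
have yc n z : z * u = u * z -> z * sqrt_iter u n = sqrt_iter u n * z.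
  move=> zu; elim: n => [|n IH] /=; first by rewrite mulr0 mul0r.
  by rewrite -scalerAr -scalerAl mulrDr mulrDl zu mulrA IH -mulrA IH mulrA.
(* Both increments are half a difference of squares, so the bounds on the iterates and on the
   previous increment carry over. *)
have yd n : cnorm (sqrt_iter u n.+1 - sqrt_iter u n) <= sqrt_iterR n.+1 - sqrt_iterR n.
  elim: n => [|n IH].
    rewrite [sqrt_iter u 0]/= [sqrt_iterR 0]/= !subr0; exact: (yn 1%N).
  have RS m : sqrt_iterR m.+1 = 2^-1 * (1 + sqrt_iterR m * sqrt_iterR m) :> R by [].
  have e1 : sqrt_iter u n.+2 - sqrt_iter u n.+1 =
     rc 2^-1 *: (sqrt_iter u n.+1 * sqrt_iter u n.+1 - sqrt_iter u n * sqrt_iter u n).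
    by rewrite [in LHS]/= -scalerBr opprD addrACA subrr add0r.
  have e2 : sqrt_iterR n.+2 - sqrt_iterR n.+1 =
     2^-1 * ((sqrt_iterR n.+1 + sqrt_iterR n) * (sqrt_iterR n.+1 - sqrt_iterR n)) :> R.
    by rewrite !(RS n.+1) (RS n); field.
  rewrite e1 e2 cnormZr ger0_norm // ler_wpM2l //.
  apply: (le_trans (cnorm_sqrB _ _)); apply: ler_pM => //.
    by rewrite addr_ge0 // cnorm_ge0.
    exact: cnorm_ge0.
  exact: lerD.
have yd2 m n : (m <= n)%N ->
    cnorm (sqrt_iter u n - sqrt_iter u m) <= sqrt_iterR n - sqrt_iterR m.
  elim: n => [|n IH]; first by rewrite leqn0 => /eqP ->; rewrite !subrr cnorm0.
  rewrite leq_eqVlt => /orP[/eqP ->|]; first by rewrite !subrr cnorm0.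
  rewrite ltnS => /IH h.
  rewrite -(subrKA (sqrt_iter u n)); apply: (le_trans (cnormD _ _)).
  by have := yd n; move: h; lra.
have [y hy] : exists l : A, forall e : R, 0 < e -> exists N : nat,
      forall n : nat, (N <= n)%N -> cnorm (sqrt_iter u n - l) < e.
  apply: cnorm_complete => e e0.
  have e2 : 0 < e / 2 by rewrite divr_gt0.
  have [N hN] := monotone_bounded_cauchy sqrt_iterR_mono
    (fun n => proj2 (andP (sqrt_iterR_bounds n))) e2.
  exists N => m n hm hn.
  rewrite -(subrKA (sqrt_iter u N)); apply: (le_lt_trans (cnormD _ _)).
  rewrite (cnormBC (sqrt_iter u N)).
  have := yd2 _ _ hm; have := yd2 _ _ hn; have := hN _ hm; have := hN _ hn; lra.
have yapp e : 0 < e -> exists n, cnorm (sqrt_iter u n - y) < e /\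
    cnorm (sqrt_iter u n.+1 - y) < e.
  move=> /hy[N hN]; exists N; split; [exact: hN|exact: hN (leqnSn N)].
have ny : cnorm y <= 1.
  apply: (@ler_of_forall_addM _ _ _ 1) => e e0 _; have [n [h _]] := yapp e e0.
  have := cnormB (sqrt_iter u n) (sqrt_iter u n - y).
  rewrite opprB addrCA subrr addr0.
  have := yn n; have /andP[_] := @sqrt_iterR_bounds R n; lra.
exists y; split => //.
- apply/eqP; rewrite -subr_eq0; apply/eqP/cnorm_le0.
  apply: (@ler_of_forall_addM _ _ _ 2) => e e0 _; have [n [h _]] := yapp e e0.
  rewrite -(subrKA (sqrt_iter u n)); apply: (le_trans (cnormD _ _)).
  rewrite -{1}(ys n) -starB cnorm_star cnormBC; lra.
- have E : rc 2 *: y = u + y * y.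
    apply/eqP; rewrite -subr_eq0; apply/eqP/cnorm_le0.
    (* The defect is [2 (y - y_(n+1)) + (y_n^2 - y^2)]; each summand is at most [2 e], because [y_n]
       and [y] lie in the unit ball. *)
    apply: (@ler_of_forall_addM _ _ _ 4) => e e0 _; have [n [h h']] := yapp e e0.
    have E1 : u = rc 2 *: sqrt_iter u n.+1 - sqrt_iter u n * sqrt_iter u n.
      by rewrite /= scalerA -rmorphM mulfV ?pnatr_eq0 // scale1r addrK.
    have -> : rc 2 *: y - (u + y * y) = rc 2 *: (y - sqrt_iter u n.+1) +
       (sqrt_iter u n * sqrt_iter u n - y * y).
      by rewrite scalerBr -!addrA; congr (_ + _); rewrite {1}E1 !opprD opprK !addrA.
    apply: (le_trans (cnormD _ _)); rewrite cnormZr (cnormBC y) ger0_norm ?ler0n //.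
    have := cnorm_sqrB (sqrt_iter u n) y.
    have := yn n; have /andP[_] := @sqrt_iterR_bounds R n.
    have := cnorm_ge0 (sqrt_iter u n); have := cnorm_ge0 y.
    have := cnorm_ge0 (sqrt_iter u n - y).
    by nra.
  have E2 : y * y = y + y - u by rewrite -scr2 E addrAC subrr add0r.
  by rewrite mulrBr mulr1 mulrBl mul1r opprB E2 (addrAC (y + y)) addrK addrA subrK.
- move=> z zu; apply/eqP; rewrite -subr_eq0; apply/eqP/cnorm_le0.
  apply: (@ler_of_forall_addM _ _ _ (2 * cnorm z)) => e e0 _.
  have [n [h _]] := yapp e e0.
  have -> : z * y - y * z = (sqrt_iter u n - y) * z - z * (sqrt_iter u n - y).
    by rewrite mulrBr mulrBl (yc n z zu) opprB [RHS]addrC subrKA.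
  apply: (le_trans (cnormB _ _)).
  have := cnormM (sqrt_iter u n - y) z; have := cnormM z (sqrt_iter u n - y).
  by have := cnorm_ge0 z; nra.
Qed.

Lemma sc_mul r s : sc r * sc s = sc (r * s).
Proof. by rewrite scM scalerA -rmorphM. Qed.

Lemma sc0 : sc 0 = 0.
Proof. exact: scale0r. Qed.

Lemma starI x : star ('i%C *: x) = - ('i%C *: star x).
Proof.
rewrite starZ (_ : Num.conj 'i%C = - 'i%C :> R[i]) ?scaleNr //.
by rewrite /= -[RHS]/(Complex _ _) oppr0.
Qed.

Lemma scaleii x : 'i%C *: ('i%C *: x) = - x.
Proof. by rewrite scalerA -expr2 sqr_i scaleN1r. Qed.

Lemma addxx_eq0 x : x + x = 0 -> x = 0.
Proof.
move=> e; apply: cnorm_le0; have := cnormZr 2 x.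
by rewrite scr2 e cnorm0 gtr0_norm ?ltr0n //; lra.
Qed.

(** * The positive cone *)

(* Equivalent for self-adjoint [h] to the spectral condition, and easier to
   handle: it makes the positive elements an obviously convex cone. *)
Definition pos (h : A) : Prop :=
  star h = h /\ exists2 r, 0 <= r & cnorm (sc r - h) <= r.

Lemma pos_sa h : pos h -> star h = h.
Proof. by case. Qed.

(** After enlarging the radius to make it nonzero, [u = 1 - h / r] lies in the unit ball, and
    [sqrt r (1 - y)] is the root; it is positive with radius [sqrt r] because [cnorm y <= 1]. *)
Lemma pos_sqrt h : pos h ->
  exists k, [/\ pos k, k * k = h & forall z, z * h = h * z -> z * k = k * z].
Proof.
move=> [sh [r0 r0ge hr0]]; pose r := r0 + 1.
have rgt : 0 < r by rewrite /r; lra.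
have rn0 : r != 0 by rewrite gt_eqF.
have hr : cnorm (sc r - h) <= r.
  rewrite /r scrD addrAC; apply: (le_trans (cnormD _ _)).
  by rewrite cnorm_sc normr1 lerD2r.
pose u := 1 - rc r^-1 *: h.
have uE : u = rc r^-1 *: (sc r - h).
  by rewrite scalerBr scalerA -rmorphM mulVf // scale1r.
have su : star u = u by rewrite starB star1 starZr sh.
have nu : cnorm u <= 1.
  by rewrite uE cnormZr gtr0_norm ?invr_gt0 // ler_pdivrMl // mulr1.
have [y [sy ny yE yc]] := sqrt_one_sub su nu.
exists (rc (Num.sqrt r) *: (1 - y)); split.
- split; first by rewrite starZr starB star1 sy.
  exists (Num.sqrt r); first exact: sqrtr_ge0.
  rewrite -scalerBr opprB addrCA subrr addr0 cnormZr ger0_norm ?sqrtr_ge0 //.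
  by rewrite ler_piMr ?sqrtr_ge0.
- rewrite -scalerAl -scalerAr scalerA yE -rmorphM -expr2 sqr_sqrtr ?ltW //.
  by rewrite /u opprB addrCA subrr addr0 scalerA -rmorphM mulfV // scale1r.
- move=> z zh; rewrite -scalerAr -scalerAl mulrBr mulrBl mulr1 mul1r yc //.
  by rewrite /u mulrBr mulrBl mulr1 mul1r -scalerAr -scalerAl zh.
Qed.

(* [h + i k] is [r] times a unitary, and [h] is its real part. *)
Lemma cnorm_le_of_sqr_add h k r : 0 <= r -> star h = h -> star k = k ->
  h * k = k * h -> h * h + k * k = sc (r ^+ 2) -> cnorm h <= r.
Proof.
move=> r0 sh sk hk E; pose w := h + 'i%C *: k.
have sw : star w = h - 'i%C *: k by rewrite starD starI sh sk.
have ww : star w * w = sc (r ^+ 2).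
  rewrite sw mulrBl !mulrDr -!scalerAl -!scalerAr scaleii -hk opprD opprK.
  by rewrite addrA addrK.
have nw : cnorm w = r.
  apply/eqP; rewrite -(eqrXn2 (n := 2)) ?cnorm_ge0 // -cnorm_starM ww cnorm_sc.
  by rewrite ger0_norm ?sqr_ge0.
have : cnorm (rc 2 *: h) <= r + r.
  have -> : rc 2 *: h = w + star w by rewrite scr2 sw addrACA subrr addr0.
  by apply: (le_trans (cnormD _ _)); rewrite cnorm_star nw.
rewrite cnormZr ger0_norm ?ler0n //; lra.
Qed.

(** With [k] a root of [1 - h^2], the element [h + i k] is unitary, so [k] is also in the unit ball
    and [1 - h^2 = k^2]. *)
Lemma unit_ball_one_sub_sqr h : star h = h -> cnorm h <= 1 ->
  cnorm (1 - h * h) <= 1.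
Proof.
move=> sh nh.
have nu : cnorm (h * h) <= 1 by rewrite cnorm_sqr // expr_le1 ?cnorm_ge0.
have su : star (h * h) = h * h by rewrite starM sh.
have [y [sy ny yE yc]] := sqrt_one_sub su nu.
pose k := 1 - y.
have sk : star k = k by rewrite starB star1 sy.
have hk : h * k = k * h by rewrite mulrBr mulrBl yc ?mulrA // mulr1 mul1r.
have nk : cnorm k <= 1.
  by apply: (@cnorm_le_of_sqr_add _ h) => //; rewrite -?yE ?expr1n ?scr1 ?yE ?subrK.
by rewrite -yE cnorm_sqr // expr_le1 ?cnorm_ge0.
Qed.

Lemma cnorm_sub_sqr h r : star h = h -> cnorm h ^+ 2 <= r ->
  cnorm (sc r - h * h) <= r.
Proof.
move=> sh hr.
have r0 : 0 <= r by apply: le_trans hr; exact: sqr_ge0.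
have [r00|rn] := eqVneq r 0.
  have h0 : h * h = 0 by apply: cnorm_le0; rewrite cnorm_sqr // -r00.
  by rewrite h0 subr0 cnorm_sc ger0_norm.
have rgt : 0 < r by rewrite lt_def rn.
have s0 : 0 < Num.sqrt r by rewrite sqrtr_gt0.
pose s := rc (Num.sqrt r)^-1 *: h.
have ss : star s = s by rewrite starZr sh.
have ns : cnorm s <= 1.
  rewrite cnormZr gtr0_norm ?invr_gt0 // ler_pdivrMl // mulr1.
  by rewrite -(ler_pXn2r (n := 2)) ?nnegrE ?cnorm_ge0 ?sqrtr_ge0 // sqr_sqrtr.
have E : sc r - h * h = rc r *: (1 - s * s).
  have q : r * ((Num.sqrt r)^-1 * (Num.sqrt r)^-1) = 1.
    by rewrite -invfM -expr2 sqr_sqrtr // mulfV.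
  by rewrite scalerBr /s -scalerAl -scalerAr !scalerA -!rmorphM -mulrA q scale1r.
rewrite E cnormZr ger0_norm // ler_piMr //; exact: unit_ball_one_sub_sqr.
Qed.

Lemma pos_sqr h : star h = h -> pos (h * h).
Proof.
move=> sh; split; first by rewrite starM sh.
by exists (cnorm h ^+ 2); [exact: sqr_ge0|exact: cnorm_sub_sqr].
Qed.

(** The radius in [pos] is existential; this frees it to be any bound of the norm, which is what
    closedness of the cone requires. *)
Lemma pos_cnorm_sub h r : pos h -> cnorm h <= r -> cnorm (sc r - h) <= r.
Proof.
move=> /pos_sqrt[k [[sk _] <- _]]; rewrite cnorm_sqr //; exact: cnorm_sub_sqr.
Qed.

Lemma pos_of_cnorm_sub h r : star h = h -> cnorm (sc r - h) <= r -> pos h.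
Proof.
by move=> sh hr; split => //; exists r => //; apply: le_trans hr; exact: cnorm_ge0.
Qed.

Lemma pos_sc r : 0 <= r -> pos (sc r).
Proof.
by move=> r0; apply: (@pos_of_cnorm_sub _ r); rewrite ?star_sc // subrr cnorm0.
Qed.

Lemma pos0 : pos 0.
Proof. by rewrite -sc0; exact: pos_sc. Qed.

Lemma pos_sc_sub h r : star h = h -> cnorm h <= r -> pos (sc r - h).
Proof.
move=> sh hr; apply: (@pos_of_cnorm_sub _ r); first by rewrite starB star_sc sh.
by rewrite opprB addrCA subrr addr0.
Qed.

Lemma pos_sc_add h r : star h = h -> cnorm h <= r -> pos (sc r + h).
Proof.
by move=> sh hr; rewrite -[h]opprK; apply: pos_sc_sub; rewrite ?starN ?sh ?cnormN.
Qed.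

Lemma pos_add x y : pos x -> pos y -> pos (x + y).
Proof.
move=> [sx [r r0 hr]] [sy [s s0 hs]]; apply: (@pos_of_cnorm_sub _ (r + s)).
  by rewrite starD sx sy.
rewrite scrD opprD addrACA; apply: (le_trans (cnormD _ _)); exact: lerD.
Qed.

Lemma pos_scale r x : 0 <= r -> pos x -> pos (rc r *: x).
Proof.
move=> r0 [sx [s s0 hs]]; apply: (@pos_of_cnorm_sub _ (r * s)).
  by rewrite starZr sx.
by rewrite rmorphM -scalerA -scalerBr cnormZr ger0_norm // ler_wpM2l.
Qed.

Lemma pos_closed h : star h = h -> (forall e, 0 < e -> pos (sc e + h)) -> pos h.
Proof.
move=> sh H; apply: (@pos_of_cnorm_sub _ (cnorm h)) => //.
apply: (@ler_of_forall_addM _ _ _ 1) => e e0 _.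
have : cnorm (sc (cnorm h + e) - (sc e + h)) <= cnorm h + e.
  apply: pos_cnorm_sub; first exact: H.
  apply: (le_trans (cnormD _ _)); rewrite cnorm_sc gtr0_norm //; lra.
by rewrite scrD opprD addrA addrK mul1r.
Qed.

Lemma pos_mul x y : pos x -> pos y -> x * y = y * x -> pos (x * y).
Proof.
move=> /pos_sqrt[k [[sk _] <- kc]] /pos_sqrt[j [[sj _] <- jc]] xy.
have kj : k * j = j * k by apply: jc; apply: esym; apply: kc.
have -> : k * k * (j * j) = (k * j) * (k * j).
  by rewrite -!mulrA; congr (_ * _); rewrite !mulrA kj.
by apply: pos_sqr; rewrite starM sk sj kj.
Qed.

(** For commuting roots [k] of [h] and [j] of [- h], [w = k + i j] has [star w * w = 0]. Hence
    [k = - i j], and taking adjoints gives [k = - k]. *)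
Lemma pos_anti h : pos h -> pos (- h) -> h = 0.
Proof.
move=> /pos_sqrt[k [[sk _] kk kc]] /pos_sqrt[j [[sj _] jj jc]].
have kj : k * j = j * k.
  by apply: jc; apply: esym; rewrite mulNr mulrN; congr (- _); rewrite -kk mulrA.
pose w := k + 'i%C *: j.
have sw : star w = k - 'i%C *: j by rewrite starD starI sk sj.
have : star w * w = 0.
  rewrite sw mulrBl !mulrDr -!scalerAl -!scalerAr scaleii -kj kk jj opprD !opprK.
  by rewrite addrA addrK subrr.
move=> /star_sqr_eq0 w0.
have kE : k = - ('i%C *: j) by apply/eqP; rewrite -addr_eq0 -/w w0.
have : k = - k by rewrite -{1}sk kE starN starI sj opprK.
move=> /eqP; rewrite -addr_eq0 => /eqP/addxx_eq0 k0.
by rewrite -kk k0 mulr0.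
Qed.

Lemma pos_add_eq0 x y : pos x -> pos y -> x + y = 0 -> x = 0.
Proof.
by move=> px py /eqP; rewrite addr_eq0 => /eqP e; apply: pos_anti; rewrite // e opprK.
Qed.

Lemma sa_cube_eq0 h : star h = h -> h * h * h = 0 -> h = 0.
Proof.
move=> sh h3; apply: sa_sqr_eq0 => //; apply: sa_sqr_eq0; first by rewrite starM sh.
by rewrite mulrA h3 mul0r.
Qed.

(** Let [P] be the absolute value of [z] and [N = P - z], twice its negative part. Then [(P N)^2]
    and [m P N^2] are positive with sum 0, so [P N = 0] and [N^2 = 2 P N = 0]. It serves to show
    that the positive part [(m + h) / 2], with [m] the absolute value of [h], is positive. *)
Lemma pos_of_sqr_eq_mul m z : star z = z -> pos m -> m * z = z * m ->
  z * z = m * z -> pos z.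
Proof.
move=> sz pm mz zz.
have [P [pP PP Pc]] := pos_sqrt (pos_sqr sz).
have zP : z * P = P * z by apply: Pc; rewrite mulrA.
have mP : m * P = P * m by apply: Pc; rewrite mulrA mz -mulrA mz mulrA.
have sP := pos_sa pP.
pose N := P - z.
have sN : star N = N by rewrite starB sP sz.
have PN : P * N = N * P by rewrite mulrBr mulrBl zP.
have mN : m * N = N * m by rewrite mulrBr mulrBl mz mP.
have zN : z * N = - (P * N) by rewrite !mulrBr PP zP opprB.
pose X := P * N.
have sX : star X = X by rewrite starM sP sN -PN.
have XX : X * X + m * (P * (N * N)) = 0.
  have -> : X * X = z * z * N * N.
    by rewrite -PP /X -!mulrA; congr (_ * _); rewrite !mulrA PN.
  rewrite zz !mulrA -(mulrA m z N) zN mulrN mulrA mulNr.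
  by rewrite addrC subrr.
have X0 : X = 0.
  apply: sa_sqr_eq0 => //; apply: (pos_add_eq0 _ _ XX); first exact: pos_sqr.
  apply: pos_mul => //.
    apply: pos_mul => //; first exact: pos_sqr.
    by rewrite mulrA PN -mulrA PN mulrA.
  by rewrite !mulrA mP -(mulrA P) mN !mulrA -(mulrA _ m) mN !mulrA.
have N0 : N = 0.
  apply: sa_sqr_eq0 => //; rewrite {1}/N mulrBl zN opprK -/X X0 addr0 //.
have -> : z = P by apply/esym/eqP; rewrite -subr_eq0 -/N N0.
exact: pP.
Qed.

Lemma scr_half x : rc 2^-1 *: x + rc 2^-1 *: x = x.
Proof. by rewrite -scr2 scalerA -rmorphM mulfV ?pnatr_eq0 // scale1r. Qed.

Lemma pos_half_add m h : pos m -> star h = h -> m * m = h * h -> m * h = h * m ->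
  pos (rc 2^-1 *: (m + h)).
Proof.
move=> pm sh mm mh; apply: (pos_of_sqr_eq_mul (m := m)) => //.
- by rewrite starZr starD sh (pos_sa pm).
- by rewrite -scalerAr -scalerAl mulrDr mulrDl mh.
rewrite -scalerAl -!scalerAr; congr (_ *: _).
rewrite mulrDl (mulrDr h) -mm -mh [m * h + _]addrC -mulrDr.
by rewrite scalerDr scr_half.
Qed.

Lemma sa_decomp h : star h = h ->
  exists p q, [/\ pos p, pos q, h = p - q, p * q = 0 &
    forall z, z * h = h * z -> z * p = p * z /\ z * q = q * z].
Proof.
move=> sh; have [m [pm mm mc]] := pos_sqrt (pos_sqr sh).
have mh : m * h = h * m by apply: esym; apply: mc; rewrite mulrA.
exists (rc 2^-1 *: (m + h)), (rc 2^-1 *: (m - h)); split.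
- exact: pos_half_add.
- by apply: pos_half_add; rewrite ?starN ?sh // ?mulrNN // mulrN mulNr mh.
- by rewrite -scalerBr opprB [h - m]addrC addrACA subrr add0r scalerDr scr_half.
- rewrite -scalerAl -scalerAr mulrDl !mulrBr mm mh.
  by rewrite addrA subrK subrr !scaler0.
- move=> z zh; have zm : z * m = m * z.
    by apply: mc; rewrite mulrA zh -mulrA zh mulrA.
  by split; rewrite -scalerAr -scalerAl ?mulrBr ?mulrBl ?mulrDr ?mulrDl zh zm.
Qed.

(** The sum is half of [a^2 + b^2], where [a] and [b] are, up to real factors, the real and
    imaginary parts of [x]. *)
Lemma pos_star_mul_add x : pos (star x * x + x * star x).
Proof.
pose a := x + star x; pose b := 'i%C *: (x - star x).
have sa : star a = a by rewrite starD starK addrC.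
have sb : star b = b by rewrite starI starB starK -scalerN opprB.
have -> : star x * x + x * star x = rc 2^-1 *: (a * a + b * b).
  have -> : a * a + b * b =
      (star x * x + x * star x) + (star x * x + x * star x); last first.
    by rewrite scalerDr scr_half.
  pose U := x * x + star x * star x; pose V := star x * x + x * star x.
  have -> : a * a = U + V.
    rewrite mulrDl !mulrDr /U /V -!addrA; congr (_ + _).
    by rewrite addrCA [RHS]addrCA; congr (_ + _); rewrite addrC.
  have -> : b * b = - (U - V).
    rewrite /b -scalerAl -scalerAr scaleii mulrBl !mulrBr /U /V; congr (- _).
    rewrite opprB opprD -!addrA; congr (_ + _).
    by rewrite addrCA; congr (_ + _); rewrite addrC.
  by rewrite opprB [LHS]addrC addrA subrK.
apply: pos_scale; first by rewrite invr_ge0 ler0n.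
by apply: pos_add; exact: pos_sqr.
Qed.

(* With [m = - w^* w >= 0], [v = w sqrt m] has [v^* v = - m^2] and
   [v v^* = - (w w^* )^2], although [v^* v + v v^*] is positive. *)
Lemma star_mul_pos_opp w : pos (- (star w * w)) -> w = 0.
Proof.
move=> pm; pose m := - (star w * w).
have [j [pj jj jc]] := pos_sqrt pm.
have mE : star w * w = - m by rewrite opprK.
have sj := pos_sa pj.
have jm : j * m = m * j by rewrite /m -jj mulrA.
pose n := w * star w.
have sn : star n = n by rewrite starM starK.
have sm := pos_sa pm.
have := pos_star_mul_add (w * j).
have -> : star (w * j) * (w * j) = - (m * m).
  rewrite starM sj mulrA -(mulrA j) mE mulrN mulNr jm -mulrA.
  by rewrite jj.
have -> : w * j * star (w * j) = - (n * n).
  rewrite starM sj mulrA -(mulrA w) jj /n mulrN mulNr !mulrA //.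
rewrite -opprD => p1.
have p2 : pos (m * m + n * n) by apply: pos_add; exact: pos_sqr.
have := pos_anti p2 p1 => /(pos_add_eq0 (pos_sqr sm) (pos_sqr sn)) /(sa_sqr_eq0 sm) m0.
by apply: star_sqr_eq0; rewrite -[LHS]opprK m0 oppr0.
Qed.

(** With [q] the negative part of [star x * x], the element [x * q] satisfies
    [star (x * q) * (x * q) = - q^3], so it vanishes and [q^3 = 0]. *)
Lemma pos_star_mul x : pos (star x * x).
Proof.
have sz : star (star x * x) = star x * x by rewrite starM starK.
have [p [q [pp pq zE pq0 _]]] := sa_decomp sz.
have sq := pos_sa pq.
have q3 : star (x * q) * (x * q) = - (q * q * q).
  rewrite starM sq mulrA -(mulrA q) zE mulrBr mulrBl -(mulrA q p) pq0 mulr0.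
  by rewrite sub0r.
have xq0 : x * q = 0.
  apply: star_mul_pos_opp; rewrite q3 opprK; apply: pos_mul => //.
    by apply: pos_sqr.
  by rewrite mulrA.
have q0 : q = 0.
  apply: sa_cube_eq0 => //; apply/eqP; rewrite -oppr_eq0 -q3 xq0 mulr0 //.
by rewrite zE q0 subr0.
Qed.

(** Take the least shift [l0] making [h] positive. If [l0 > 0], then [g = l0 + h] is positive with
    inverse [w], and [g (1 - e w) = g - e] remains positive for small [e], contradicting
    minimality. *)
Lemma pos_of_invertible_add h : star h = h ->
  (forall l : R, 0 < l -> invertible (h + sc l)) -> pos h.
Proof.
move=> sh H.
pose S := [set l : R | 0 < l /\ pos (sc l + h)]%classic.
have S1 : S (cnorm h + 1).
  split; first by have := cnorm_ge0 h; lra.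
  by apply: pos_sc_add => //; lra.
have hS : has_inf S by split; [exists (cnorm h + 1)|exists 0 => l [/ltW]].
pose l0 := inf S.
have l00 : 0 <= l0 by apply: lb_le_inf; [exists (cnorm h + 1)|move=> l [/ltW]].
have pl e : 0 < e -> pos (sc (l0 + e) + h).
  move=> e0; have [l [_ pl] le] := inf_adherent e0 hS.
  have -> : sc (l0 + e) + h = sc (l0 + e - l) + (sc l + h).
    by rewrite addrA -scrD subrK.
  apply: pos_add => //; apply: pos_sc; rewrite subr_ge0 ltW //.
have p0 : pos (sc l0 + h).
  apply: pos_closed; first by rewrite starD star_sc sh.
  by move=> e e0; rewrite addrA -scrD [e + _]addrC; exact: pl.
have [e|l0n] := eqVneq l0 0; first by move: p0; rewrite e sc0 add0r.
have l0p : 0 < l0 by rewrite lt_def l0n.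
have [w [w1 w2]] := H _ l0p; rewrite addrC in w1 w2.
set g := sc l0 + h in w1 w2 p0.
have sg : star g = g by exact: pos_sa.
have sw : star w = w.
  by rewrite -[star w]mulr1 -w1 mulrA -{1}sg -starM w1 star1 mul1r.
(* The first bound keeps the smaller shift positive, the second keeps [e w] in the unit ball. *)
pose e := Num.min (l0 / 2) (cnorm w + 1)^-1.
have w0 := cnorm_ge0 w.
have e0 : 0 < e by rewrite lt_min invr_gt0 divr_gt0 //=; lra.
have e1 : e <= l0 / 2 by rewrite ge_min lexx.
have e2 : e * cnorm w <= 1.
  have : e <= (cnorm w + 1)^-1 by rewrite ge_min lexx orbT.
  rewrite -[X in _ <= X]div1r ler_pdivlMr; last lra.
  by apply: le_trans; rewrite ler_pM2l //; lra.
have pe : pos (sc (l0 - e) + h).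
  have -> : sc (l0 - e) + h = g * (1 - rc e *: w).
    by rewrite mulrBr mulr1 -scalerAr w1 scrB addrAC.
  apply: pos_mul => //.
    rewrite -scr1; apply: pos_sc_sub; first by rewrite starZr sw.
    by rewrite cnormZr gtr0_norm.
  by rewrite mulrBr mulrBl mulr1 mul1r -scalerAr -scalerAl w1 w2.
have : l0 <= l0 - e by apply: ge_inf; [exact: hS.2|split => //; lra].
by lra.
Qed.

Lemma pos_of_is_positive h : is_positive h -> pos h.
Proof.
move=> [sh hs]; apply: pos_of_invertible_add => // l l0.
apply: contrapT => H; have := hs (rc (- l)); rewrite /spectrum /=.
rewrite rmorphN scaleNr opprK -rmorphN => /(_ H).
by rewrite lecR; lra.
Qed.

(** * Positive functionals and states *)

Definition pos_functional (f : A -> R[i]) : Prop :=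
  scalar f /\ (forall x, 0 <= f (star x * x)).

Lemma complex_cauchy_schwarz (P Q B C : R[i]) : 0 <= P -> 0 <= Q ->
  (forall c : R[i], 0 <= P + c * C + Num.conj c * B + c * Num.conj c * Q) ->
  C = Num.conj B /\ Normc.normc B ^+ 2 <= complex.Re P * complex.Re Q.
Proof.
case: P Q B C => [p p'] [q q'] [b b'] [c c'] hP hQ H.
move: hP hQ; rewrite !lecE /= => /andP[/eqP p'0 p0] /andP[/eqP q'0 q0]; subst p' q'.
have := H 1; rewrite lecE /= => /andP[/eqP h1 _].
have := H 'i%C; rewrite lecE /= => /andP[/eqP h2 _].
have cE : c = b by lra.
have cE' : c' = - b' by lra.
split; first by rewrite cE cE'.
rewrite /= sqr_sqrtr ?addr_ge0 ?sqr_ge0 //.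
set n := b ^+ 2 + b' ^+ 2.
have n0 : 0 <= n by rewrite addr_ge0 ?sqr_ge0.
have K (t : R) : 0 <= p + 2 * t * n + t ^+ 2 * n * q.
  have := H (Complex (t * b) (t * b')); rewrite lecE /= => /andP[_].
  by rewrite cE cE' /n; lra.
(* The quadratic is minimal at [t = - 1 / q]; for [q = 0] it is affine, and a very negative [t]
   makes it negative unless [n = 0]. *)
have [q00|qn] := eqVneq q 0.
  rewrite q00 mulr0 leNgt; apply/negP => ngt.
  have := K (- (p + 1) / (2 * n)); rewrite q00 mulr0 addr0.
  have -> : 2 * (- (p + 1) / (2 * n)) * n = - (p + 1).
    by field; rewrite gt_eqF.
  by lra.
have qgt : 0 < q by rewrite lt_def qn.
have := K (- q^-1).
have -> : p + 2 * - q^-1 * n + (- q^-1) ^+ 2 * n * q = (p * q - n) / q by field.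
by rewrite pmulr_lge0 ?invr_gt0 // subr_ge0.
Qed.

Section PosFunctional.
Context {f : A -> R[i]} (Hf : pos_functional f).

Lemma pfD x y : f (x + y) = f x + f y.
Proof. by have := Hf.1 1 x y; rewrite scale1r mul1r. Qed.

Lemma pf0 : f 0 = 0.
Proof. by apply: (addrI (f 0)); rewrite -pfD !addr0. Qed.

Lemma pfZ c x : f (c *: x) = c * f x.
Proof. by have := Hf.1 c x 0; rewrite pf0 !addr0. Qed.

Lemma pfN x : f (- x) = - f x.
Proof. by rewrite -scaleN1r pfZ mulN1r. Qed.

Lemma pfB x y : f (x - y) = f x - f y.
Proof. by rewrite pfD pfN. Qed.

Lemma pf_pos h : pos h -> 0 <= f h.
Proof. by move=> /pos_sqrt[k [[sk _] <- _]]; rewrite -{1}sk; exact: Hf.2. Qed.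

Lemma pf_cauchy_schwarz_aux x y :
  f (star x * y) = Num.conj (f (star y * x)) /\
  Normc.normc (f (star y * x)) ^+ 2 <=
    complex.Re (f (star x * x)) * complex.Re (f (star y * y)).
Proof.
apply: complex_cauchy_schwarz; [exact: Hf.2|exact: Hf.2|move=> c].
have := Hf.2 (x + c *: y); congr (0 <= _).
rewrite starD starZ mulrDl !mulrDr -!scalerAl -!scalerAr !pfD !pfZ !addrA.
by rewrite [Num.conj c * (c * _)]mulrCA.
Qed.

Lemma pf_cauchy_schwarz x y : Normc.normc (f (star y * x)) ^+ 2 <=
    complex.Re (f (star x * x)) * complex.Re (f (star y * y)).
Proof. exact: (pf_cauchy_schwarz_aux x y).2. Qed.

Lemma pf_star x : f (star x) = Num.conj (f x).
Proof. by have := (pf_cauchy_schwarz_aux x 1).1; rewrite mulr1 star1 mul1r. Qed.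

(** Cauchy-Schwarz against 1, with [star x * x] dominated by the scalar [cnorm x ^+ 2]. *)
Lemma pf_bounded x : Normc.normc (f x) <= complex.Re (f 1) * cnorm x.
Proof.
have n0 := cnorm_ge0 x.
have f1 : 0 <= complex.Re (f 1).
  by have := Hf.2 1; rewrite star1 mulr1 lecE => /andP[].
have nf : 0 <= Normc.normc (f x).
  by case: (f x) => u v; rewrite /= sqrtr_ge0.
have := pf_cauchy_schwarz x 1; rewrite star1 !mul1r => h.
have : complex.Re (f (star x * x)) <= cnorm x ^+ 2 * complex.Re (f 1).
  have : 0 <= f (sc (cnorm x ^+ 2) - star x * x).
    apply: pf_pos; apply: pos_sc_sub; first by rewrite starM starK.
    by rewrite cnorm_starM.
  rewrite pfB pfZ lecE => /andP[_] /=.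
  case: (f 1) => u v; case: (f (star x * x)) => u' v' /=.
  by rewrite mul0r subr0 subr_ge0.
move=> h'; rewrite -(ler_pXn2r (n := 2)) ?nnegrE ?mulr_ge0 //.
apply: (le_trans h); rewrite exprMn expr2 -mulrA mulrC ler_wpM2l //.
by rewrite mulrC.
Qed.

End PosFunctional.

(** * Maximal cones and existence of states *)

Definition proper_cone (C : set A) : Prop :=
  [/\ forall h, pos h -> C h, forall x, C x -> star x = x,
      forall x y, C x -> C y -> C (x + y),
      forall r x, 0 <= r -> C x -> C (rc r *: x) & ~ C (-1)].

Definition cone_adjoin (C : set A) (x : A) : set A :=
  [set z | exists c t, [/\ C c, 0 <= t & z = c + rc t *: x]]%classic.

Lemma not_pos_N1 : ~ pos (-1).
Proof.
move=> h; have := @pos_anti 1; rewrite -scr1 => /(_ (pos_sc ler01)); rewrite scr1.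
by move=> /(_ h)/eqP; apply/negP; exact: oner_neq0.
Qed.

Lemma proper_cone_pos : proper_cone [set h | pos h]%classic.
Proof.
split => //=; [exact: pos_sa|exact: pos_add|move=> r x; exact: pos_scale|].
exact: not_pos_N1.
Qed.

Lemma sub_cone_adjoin C x : proper_cone C -> (C `<=` cone_adjoin C x)%classic.
Proof. by move=> _ c Cc; exists c, 0; rewrite scale0r addr0. Qed.

Lemma proper_cone_adjoin C x : proper_cone C -> star x = x ->
  ~ cone_adjoin C x (-1) -> proper_cone (cone_adjoin C x).
Proof.
move=> pC sx nC; case: (pC) => [Cp Cs CD CZ C1]; split => //.
- by move=> h /Cp; exact: sub_cone_adjoin.
- by move=> _ [c [t [/Cs c_sa t0 ->]]]; rewrite starD starZr c_sa sx.
- move=> _ _ [c [t [Cc t0 ->]]] [d [s [Cd s0 ->]]].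
  exists (c + d), (t + s); rewrite addr_ge0 // rmorphD scalerDl addrACA.
  by split => //; apply: CD.
- move=> r _ r0 [c [t [Cc t0 ->]]].
  exists (rc r *: c), (r * t); rewrite mulr_ge0 // rmorphM -scalerA -scalerDr.
  by split => //; apply: CZ.
Qed.

Lemma maximal_proper_cone C0 : proper_cone C0 ->
  exists C, [/\ (C0 `<=` C)%classic, proper_cone C &
    forall D, proper_cone D -> (C `<=` D)%classic -> (D `<=` C)%classic].
Proof.
move=> pC0.
(* Joining [C0] to [X] makes the property hold for the union of the empty chain as well. *)
pose P (X : set A) := proper_cone (C0 `|` X)%classic.
have [F FP Ft|X [PX mX]] := @Zorn_bigcup A P.
  have PC0 : P set0 by rewrite /P setU0.
  have two x y : (C0 `|` \bigcup_(X in F) X)%classic x ->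
      (C0 `|` \bigcup_(X in F) X)%classic y -> exists X, [/\ P X, (C0 `|` X)%classic x,
         (C0 `|` X)%classic y & (X `<=` \bigcup_(X in F) X)%classic].
    have FS X : F X -> (X `<=` \bigcup_(X in F) X)%classic by move=> FX z Xz; exists X.
    move=> [cx|[X FX Xx]] [cy|[Y FY Yy]].
    - by exists set0; split => //; left.
    - by exists Y; split => //; [exact: FP|left|right|exact: FS].
    - by exists X; split => //; [exact: FP|right|left|exact: FS].
    - by have [XY|YX] := Ft _ _ FX FY; [exists Y|exists X]; split; auto; right; auto.
  have up X : (X `<=` \bigcup_(X in F) X)%classic ->
      (C0 `|` X `<=` C0 `|` \bigcup_(X in F) X)%classic by move=> ?; exact: setUS.
  split.
  - by case: pC0 => H _ _ _ _ h /H; left.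
  - by move=> x Cx; have [X [[_ H _ _ _] /H]] := two _ _ Cx Cx.
  - move=> x y Cx Cy; have [X [[_ _ H _ _] hx hy /up]] := two _ _ Cx Cy.
    by apply; exact: H.
  - move=> r x r0 Cx; have [X [[_ _ _ H _] hx _ /up]] := two _ _ Cx Cx.
    by apply; exact: H.
  - by move=> Cx; have [X [[_ _ _ _ H] hx]] := two _ _ Cx Cx.
exists (C0 `|` X)%classic; split => //.
move=> D pD CD z Dz; right; apply: contrapT => nX; apply: (mX D).
  by split => [y Xy|DX]; [apply: CD; right|apply: nX; exact: DX].
suff -> : P D = proper_cone D by [].
by rewrite /P setUidr // => y Cy; apply: CD; left.
Qed.

Lemma proper_cone_N C r : proper_cone C -> C (sc r) -> 0 <= r.
Proof.
move=> [_ _ _ CZ C1] Cr; rewrite leNgt; apply/negP => r0; apply: C1.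
have -> : -1 = rc (- r^-1) *: sc r.
  by rewrite scalerA -rmorphM mulNr mulVf ?lt_eqF // rmorphN scaleNr scr1.
by apply: CZ => //; rewrite oppr_ge0 invr_le0 ltW.
Qed.

(** Otherwise maximality gives [-1 = c + t x = d - s x] with [c], [d] in [C], and eliminating [x]
    puts [- (s + t) = s c + t d] in [C]. *)
Lemma maximal_cone_total C : proper_cone C ->
  (forall D, proper_cone D -> (C `<=` D)%classic -> (D `<=` C)%classic) ->
  forall x, star x = x -> C x \/ C (- x).
Proof.
move=> pC mC x sx; case: (pC) => [Cp Cs CD CZ C1].
have K y : star y = y -> ~ C y -> cone_adjoin C y (-1).
  move=> sy nC; apply: contrapT => nA; apply: nC.
  apply: (mC _ (proper_cone_adjoin pC sy nA)); first exact: sub_cone_adjoin.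
  exists 0, 1; rewrite ler01 scale1r add0r; split => //; apply: Cp; exact: pos0.
have [Cx|nCx] := pselect (C x); first by left.
have [Cx|nCx'] := pselect (C (- x)); first by right.
exfalso.
have sx' : star (- x) = - x by rewrite starN sx.
have [c [t [Cc t0 e1]]] := K x sx nCx.
have [d [s [Cd s0 e2]]] := K (- x) sx' nCx'.
have [ts0|tsn] := eqVneq (t + s) 0.
  have t00 : t = 0 by lra.
  by apply: C1; rewrite e1 t00 scale0r addr0.
have tsp : 0 < t + s by rewrite lt_def tsn addr_ge0.
suff : C (sc (- (t + s))) by move=> /(proper_cone_N pC); lra.
have -> : sc (- (t + s)) = rc s *: c + rc t *: d.
  have -> : c = - 1 - rc t *: x by rewrite e1 addrK.
  have -> : d = - 1 + rc s *: x by rewrite e2 scalerN subrK.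
  rewrite scalerBr scalerDr !scalerA -!rmorphM [s * t]mulrC addrACA addNr addr0.
  by rewrite !scalerN -opprD -scrD addrC rmorphN scaleNr.
by apply: CD; apply: CZ.
Qed.

Definition re_part x : A := rc 2^-1 *: (x + star x).
Definition im_part x : A := rc 2^-1 *: ('i%C *: (star x - x)).

Lemma re_part_sa x : star (re_part x) = re_part x.
Proof. by rewrite starZr starD starK addrC. Qed.

Lemma im_part_sa x : star (im_part x) = im_part x.
Proof. by rewrite starZr starI starB starK -scalerN opprB. Qed.

Lemma re_im_partE x : x = re_part x + 'i%C *: im_part x.
Proof.
rewrite /im_part scalerA [_ * rc _]mulrC -scalerA scaleii opprB -scalerDr.
by rewrite addrACA subrr addr0 scalerDr scr_half.
Qed.

Lemma re_part_sa_add p q : star p = p -> star q = q -> re_part (p + 'i%C *: q) = p.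
Proof.
move=> sp sq; rewrite /re_part starD starI sp sq addrACA subrr addr0.
by rewrite scalerDr scr_half.
Qed.

Lemma im_part_sa_add p q : star p = p -> star q = q -> im_part (p + 'i%C *: q) = q.
Proof.
move=> sp sq; rewrite /im_part starD starI sp sq opprD addrACA subrr add0r.
by rewrite -opprD scalerN scalerDr scaleii opprD !opprK scalerDr scr_half.
Qed.

(* For a maximal proper cone [C], every [h - t] or its opposite lies in [C], and
   [g h] is the threshold [t] at which [h - t] leaves [C]. *)
Lemma exists_real_functional C : proper_cone C ->
  (forall D, proper_cone D -> (C `<=` D)%classic -> (D `<=` C)%classic) ->
  exists g : A -> R, [/\ g 1 = 1, forall h, C h -> 0 <= g h &
    forall u v h k, star h = h -> star k = k ->
      g (rc u *: h + rc v *: k) = u * g h + v * g k].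
Proof.
move=> pC mC; case: (pC) => [Cp Cs CD CZ C1].
have Ct := maximal_cone_total pC mC.
have Csc r : 0 <= r -> C (sc r) by move=> r0; apply: Cp; exact: pos_sc.
pose Fr h s := (forall t, t < s -> C (h - sc t)) /\ (forall t, s < t -> C (sc t - h)).
(* Self-adjointness stays under the existential so that [choice] yields a total function; only its
   values on self-adjoint elements are constrained. *)
have FrE h : exists s, star h = h -> Fr h s.
  have [sh|] := pselect (star h = h); last by exists 0.
  pose S := [set t | C (h - sc t)]%classic.
  have S1 : S (- cnorm h).
    rewrite /S /= rmorphN scaleNr opprK addrC; apply: Cp; exact: pos_sc_add.
  have Sb t : S t -> t <= cnorm h.
    rewrite /S /= => St; rewrite -subr_ge0; apply: (proper_cone_N pC).
    have -> : sc (cnorm h - t) = (sc (cnorm h) - h) + (h - sc t).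
      by rewrite addrA subrK scrB.
    by apply: CD => //; apply: Cp; exact: pos_sc_sub.
  have hS : has_sup S by split; [exists (- cnorm h)|exists (cnorm h)].
  have Sd t t' : S t' -> t <= t' -> S t.
    rewrite /S /= => St tt'; have -> : h - sc t = (h - sc t') + sc (t' - t).
      by rewrite scrB addrA subrK.
    by apply: CD => //; apply: Csc; rewrite subr_ge0.
  exists (sup S) => _; split => t ht.
    have [t' St' tt'] := sup_gt hS.1 ht.
    by apply: Sd St' _; exact: ltW.
  have [] := Ct (h - sc t); rewrite ?starB ?star_sc ?sh ?opprB // => St.
  by have := ub_le_sup hS.2 St; rewrite leNgt ht.
have [g gP] := choice FrE.
have Fr_le h s s' : Fr h s -> Fr h s' -> s' <= s.
  move=> [_ h1] [h2 _]; rewrite leNgt; apply/negP => ss'.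
  (* The two points trisect the interval from [s] to [s']; adding the memberships puts the negative
     scalar [(s - s') / 3] in [C]. *)
  have := CD _ _ (h1 ((2 * s + s') / 3) ltac:(lra)) (h2 ((s + 2 * s') / 3) ltac:(lra)).
  rewrite addrA subrK -scrB => /(proper_cone_N pC); lra.
have Fr_uniq h s s' : Fr h s -> Fr h s' -> s = s'.
  by move=> F1 F2; apply/eqP; rewrite eq_le (Fr_le h s' s) // (Fr_le h s s').
have FrD h k s s' : Fr h s -> Fr k s' -> Fr (h + k) (s + s').
  move=> [h1 h2] [k1 k2]; split => t ht.
    have := CD _ _ (h1 (s - (s + s' - t) / 2) ltac:(lra))
                   (k1 (s' - (s + s' - t) / 2) ltac:(lra)).
    rewrite addrACA -opprD -scrD; congr (C (_ - sc _)); lra.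
  have := CD _ _ (h2 (s - (s + s' - t) / 2) ltac:(lra))
                 (k2 (s' - (s + s' - t) / 2) ltac:(lra)).
  rewrite addrACA -opprD -scrD; congr (C (sc _ - _)); lra.
have FrN h s : Fr h s -> Fr (- h) (- s).
  move=> [h1 h2]; split => t ht.
    have := h2 (- t) ltac:(lra).
    by rewrite rmorphN scaleNr addrC.
  have := h1 (- t) ltac:(lra).
  by rewrite rmorphN scaleNr opprK addrC opprK.
have FrZp r h s : 0 < r -> Fr h s -> Fr (rc r *: h) (r * s).
  move=> r0 [h1 h2]; split => t ht.
    have := CZ r _ (ltW r0) (h1 (t / r) ltac:(by rewrite ltr_pdivrMr // mulrC)).
    by rewrite scalerBr scalerA -rmorphM mulrCA mulfV ?gt_eqF // mulr1.
  have := CZ r _ (ltW r0) (h2 (t / r) ltac:(by rewrite ltr_pdivlMr // mulrC)).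
  by rewrite scalerBr scalerA -rmorphM mulrCA mulfV ?gt_eqF // mulr1.
have Fr0 : Fr 0 0.
  split => t ht; first by rewrite sub0r -scaleNr -rmorphN; apply: Csc; lra.
  by rewrite subr0; apply: Csc; lra.
have FrZ r h s : Fr h s -> Fr (rc r *: h) (r * s).
  move=> F; have [r0|r0|->] := ltgtP r 0; last by rewrite scale0r mul0r.
    have := FrN _ _ (FrZp (- r) h s ltac:(by rewrite oppr_gt0) F).
    by rewrite rmorphN scaleNr mulNr !opprK.
  exact: FrZp.
exists g; split.
- apply: (Fr_uniq 1); first by apply: gP; exact: star1.
  split => t ht.
    by have := Csc (1 - t) ltac:(lra); rewrite scrB scr1.
  by have := Csc (t - 1) ltac:(lra); rewrite scrB scr1.
- move=> h Ch; rewrite leNgt; apply/negP => gh.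
  have [_ F2] := gP h (Cs _ Ch).
  have := CD _ _ (F2 (g h / 2) ltac:(lra)) Ch.
  rewrite subrK => /(proper_cone_N pC); lra.
- move=> u v h k sh sk; apply: (Fr_uniq (rc u *: h + rc v *: k)).
    by apply: gP; rewrite starD !starZr sh sk.
  by apply: FrD; apply: FrZ; exact: gP.
Qed.

Lemma exists_state_of_cone C0 : proper_cone C0 ->
  exists2 f, states A f & forall h, C0 h -> 0 <= f h.
Proof.
move=> pC0; have [C [C0C pC mC]] := maximal_proper_cone pC0.
have [g [g1 gpos glin]] := exists_real_functional pC mC.
case: (pC) => [Cp Cs _ _ _].
have g0 : g 0 = 0.
  by have := glin 0 0 0 0 star0 star0; rewrite !scale0r addr0 !mul0r addr0.
pose f x := Complex (g (re_part x)) (g (im_part x)).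
have fsa h : star h = h -> f h = rc (g h).
  move=> sh; rewrite /f -[in re_part h](addr0 h) -[in im_part h](addr0 h).
  rewrite -(scaler0 _ 'i%C) re_part_sa_add ?im_part_sa_add ?star0 // g0 //.
have fpos h : C h -> 0 <= f h.
  by move=> Ch; rewrite fsa ?Cs // ler0c gpos.
exists f; last by move=> h /C0C; exact: fpos.
split; first last.
- by rewrite fsa ?star1 // g1.
- by move=> x; apply: fpos; apply: Cp; exact: pos_star_mul.
move=> [u v] x y.
set a := re_part x; set b := im_part x; set c := re_part y; set d := im_part y.
have sa : star a = a := re_part_sa x.
have sb : star b = b := im_part_sa x.
have sc' : star c = c := re_part_sa y.
have sd : star d = d := im_part_sa y.
have xE : x = a + 'i%C *: b := re_im_partE x.
have yE : y = c + 'i%C *: d := re_im_partE y.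
have fx : f x = Complex (g a) (g b) by [].
have fy : f y = Complex (g c) (g d) by [].
clearbody a b c d.
have uvE : Complex u v = rc u + 'i%C * rc v by rewrite {1}[LHS]complexE.
have E : Complex u v *: x + y =
   ((rc u *: a + rc (- v) *: b) + c) + 'i%C *: ((rc u *: b + rc v *: a) + d).
  have -> : Complex u v *: x =
      (rc u *: a + rc (- v) *: b) + 'i%C *: (rc u *: b + rc v *: a).
    rewrite xE uvE scalerDl !scalerDr !scalerA.
    rewrite ['i%C * rc v * 'i%C]mulrAC -expr2 sqr_i mulN1r -rmorphN [rc u * _]mulrC.
    by rewrite [RHS]addrAC !addrA.
  by rewrite yE addrACA -scalerDr.
have s1 : star (rc u *: a + rc (- v) *: b) = rc u *: a + rc (- v) *: b.
  by rewrite starD !starZr sa sb.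
have s2 : star (rc u *: b + rc v *: a) = rc u *: b + rc v *: a.
  by rewrite starD !starZr sa sb.
have gD h k : star h = h -> star k = k -> g (h + k) = g h + g k.
  by move=> sh sk; have := glin 1 1 h k sh sk; rewrite !scale1r !mul1r.
rewrite {1}/f E re_part_sa_add ?im_part_sa_add;
  try by rewrite starD ?s1 ?s2 ?sc' ?sd.
rewrite fx fy (gD _ c) // (gD _ d) // !glin //.
by congr Complex => /=; ring.
Qed.

(** If [- k] is not positive, neither is [e - k] for some [e > 0], so [k - e] can be adjoined to the
    positive cone without reaching [-1]; the resulting state has value at least [e] at [k]. One of
    [h], [- h] can play the role of [k]. *)
Lemma exists_state_neq0 h : star h = h -> h <> 0 ->
  exists2 f, states A f & f h <> 0.
Proof.
have main k : star k = k -> ~ pos (- k) -> exists2 f, states A f & f k <> 0.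
  move=> sk nk.
  have [e e0 ne] : exists2 e, 0 < e & ~ pos (sc e - k).
    apply: contrapT => H; apply: nk; apply: pos_closed; first by rewrite starN sk.
    by move=> e e0; apply: contrapT => ne; apply: H; exists e.
  have pC : proper_cone (cone_adjoin [set x | pos x]%classic (k - sc e)).
    apply: proper_cone_adjoin; first exact: proper_cone_pos.
      by rewrite starB star_sc sk.
    move=> [p [t [/= pp t0 E]]].
    have [t00|tn] := eqVneq t 0.
      by move: E; rewrite t00 scale0r addr0 => E; apply: not_pos_N1; rewrite E.
    apply: ne; have -> : sc e - k = rc t^-1 *: (p + 1).
      have -> : p + 1 = rc t *: (sc e - k).
        by apply/eqP; rewrite -[_ - k]opprB scalerN -addr_eq0 addrAC -E addNr.
      by rewrite scalerA -rmorphM mulVf // scale1r.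
    apply: pos_scale; first by rewrite invr_ge0.
    by apply: pos_add => //; rewrite -scr1; apply: pos_sc; exact: ler01.
  have [f fst fp] := exists_state_of_cone pC.
  exists f => // fk.
  have Hf : pos_functional f by case: fst.
  have : 0 <= f (k - sc e).
    apply: fp; exists 0, 1; rewrite add0r scale1r ler01; split => //=; exact: pos0.
  case: fst => _ _ f1.
  by rewrite (pfB Hf) (pfZ Hf) fk f1 mulr1 sub0r oppr_ge0 lecR leNgt e0.
move=> sh hn.
have [ph|nph] := pselect (pos (- h)); last exact: main.
have [||f fst fh] := main (- h); first by rewrite starN sh.
  by rewrite opprK => ph'; apply: hn; exact: pos_anti.
by exists f => // fh0; apply: fh; case: fst => H1 H2 _; rewrite (@pfN f) // fh0 oppr0.
Qed.

(** * Elements of square zero *)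

Lemma cnorm_sum (I : Type) (s : seq I) (F : I -> A) :
  cnorm (\sum_(i <- s) F i) <= \sum_(i <- s) cnorm (F i).
Proof.
elim: s => [|i s IH]; first by rewrite !big_nil cnorm0.
by rewrite !big_cons; apply: (le_trans (cnormD _ _)); rewrite lerD2l.
Qed.

Lemma complete_square x r :
  (x - sc (r / 2)) * (x - sc (r / 2)) + x * (sc r - x) = sc ((r / 2) ^+ 2).
Proof.
have -> : sc r = sc (r / 2) + sc (r / 2) by rewrite -scrD; congr (sc _); field.
rewrite mulrBl !mulrBr mulrDr -(sc_comm _ x) sc_mul -expr2 opprB.
by rewrite (addrACA (x * x)) -opprD subrKA addrAC subrr add0r.
Qed.

(** By completing the square, [x - r / 2] and a root of [x (r - x)] have squares adding up to
    [(r / 2)^2], so [x] lies within [r / 2] of [r / 2]. *)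
Lemma cnorm_le_of_pos_mul_sub x r : 0 <= r -> star x = x ->
  pos (x * (sc r - x)) -> cnorm x <= r.
Proof.
move=> r0 sx /pos_sqrt[k [pk kk kc]].
have xG : x * (x - sc (r / 2)) = (x - sc (r / 2)) * x by rewrite mulrBl mulrBr sc_comm.
have nG : cnorm (x - sc (r / 2)) <= r / 2.
  apply: (@cnorm_le_of_sqr_add _ k); rewrite ?kk.
  - by rewrite divr_ge0.
  - by rewrite starB star_sc sx.
  - exact: pos_sa.
  - apply: kc; rewrite mulrA -xG -!mulrA; congr (_ * _).
    by rewrite [LHS]mulrBr [RHS]mulrBl xG (sc_comm r).
  - exact: complete_square.
rewrite -(subrK (sc (r / 2)) x); apply: (le_trans (cnormD _ _)).
by rewrite cnorm_sc ger0_norm ?divr_ge0 //; lra.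
Qed.

(* The spectral slices [p t_i - p t_(i+1)] of [b] have norm at most the mesh
   of the subdivision, and their commutators with [c] are mutually orthogonal
   because distinct slices are separated by some [p s] and [q s]. *)
Lemma sa_commute_of_reduced : (forall x, x * x = 0 -> x = 0) ->
  forall b c : A, star b = b -> star c = c -> b * c = c * b.
Proof.
move=> red b c sb sc'.
have red0 (u v : A) : u * v = 0 -> v * u = 0.
  by move=> uv; apply: red; rewrite -mulrA (mulrA u) uv mul0r mulr0.
have red1 (u v x : A) : u * v = 0 -> v * x * u = 0.
  by move=> uv; apply: red; rewrite -!mulrA (mulrA u) uv mul0r !mulr0.
have dec t : exists pq : A * A, [/\ pos pq.1, pos pq.2, b - sc t = pq.1 - pq.2,
    pq.1 * pq.2 = 0 & forall z, z * b = b * z -> z * pq.1 = pq.1 * z /\ z * pq.2 = pq.2 * z].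
  have [|p [q [pp pq e pq0 cm]]] := @sa_decomp (b - sc t).
    by rewrite starB star_sc sb.
  exists (p, q); split => // z zb; apply: cm.
  by rewrite mulrBr mulrBl zb sc_comm.
have [F FP] := choice dec.
pose p t := (F t).1; pose q t := (F t).2.
have pp t : pos (p t) by case: (FP t).
have pq t : pos (q t) by case: (FP t).
have bE t : b - sc t = p t - q t by case: (FP t).
have pq0 t : p t * q t = 0 by case: (FP t).
have qp0 t : q t * p t = 0 by exact: red0.
have bp t : b * p t = p t * b by case: (FP t) => _ _ _ _ /(_ b erefl)[].
have bq t : b * q t = q t * b by case: (FP t) => _ _ _ _ /(_ b erefl)[].
have pcm z t : z * b = b * z -> z * p t = p t * z by case: (FP t) => _ _ _ _ H /H[].
have qcm z t : z * b = b * z -> z * q t = q t * z by case: (FP t) => _ _ _ _ H /H[].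
have ppc s t : p t * p s = p s * p t by apply: pcm; rewrite bp.
have pqc s t : p s * q t = q t * p s by apply: qcm; rewrite bp.
have bdiff s t : (b - sc t) - (b - sc s) = sc (s - t).
  by rewrite scrB [LHS]addrC opprB subrKA.
(* For [t < s], [y = p s * q t] satisfies [(s - t) y + p s * y + y * q t = 0], a vanishing sum of
   positive elements. *)
have ps_qt s t : t <= s -> p s * q t = 0.
  rewrite le_eqVlt => /orP[/eqP -> //|ts].
  set y := p s * q t.
  have py : pos y by apply: pos_mul => //; apply: qcm; rewrite bp.
  have yb : b * y = y * b by rewrite /y mulrA bp -mulrA bq mulrA.
  have e1 : (b - sc t) * y = - (y * q t).
    by rewrite bE /y mulrBl mulrA (ppc s t) -(mulrA (p s) (p t)) pq0 mulr0 sub0r mulrA -pqc.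
  have e2 : (b - sc s) * y = p s * y.
    by rewrite bE /y mulrA mulrBl qp0 subr0 -mulrA.
  have e3 : rc (s - t) *: y + (p s * y + y * q t) = 0.
    have -> : rc (s - t) *: y = (b - sc t) * y - (b - sc s) * y.
      by rewrite -mulrBl bdiff scM.
    by rewrite e1 e2 subrKA addNr.
  have z0 : rc (s - t) *: y = 0.
    apply: (pos_add_eq0 _ _ e3).
      by apply: pos_scale => //; rewrite subr_ge0 ltW.
    apply: pos_add; apply: pos_mul => //.
      by apply: esym; apply: pcm; rewrite yb.
    by apply: qcm; rewrite yb.
  have := cnormZr (s - t) y; rewrite z0 cnorm0 gtr0_norm ?subr_gt0 // => /esym/eqP.
  by rewrite mulf_eq0 subr_eq0 gt_eqF //= => /eqP/cnorm_eq0.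
have qt_ps s t : t <= s -> q t * p s = 0 by move=> /ps_qt; exact: red0.
have pxq s t x : t <= s -> p s * x * q t = 0 by move=> /qt_ps; exact: red1.
have qxp s t x : t <= s -> q t * x * p s = 0 by move=> /ps_qt; exact: red1.
have slice_compl t s : sc (s - t) - (p t - p s) = q s - q t.
  by rewrite -bdiff !bE !opprB -addrA subrKA addrC subrKA.
have slice t s : t <= s -> cnorm (p t - p s) <= s - t.
  move=> ts; apply: cnorm_le_of_pos_mul_sub; first by rewrite subr_ge0.
    by rewrite starB !(pos_sa (pp _)).
  rewrite slice_compl mulrBl !mulrBr !pq0 (ps_qt s t) // !subr0.
  by apply: pos_mul => //; apply: qcm; rewrite bp.
(* The spectrum of [b] lies inside the interval from [- rho] to [rho], so the lowest negative part
   and the highest positive part vanish. *)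
pose rho := cnorm b + 1.
have nb := cnorm_ge0 b.
have q0 : q (- rho) = 0.
  apply: sa_sqr_eq0; first exact: pos_sa.
  have pb : pos (b - sc (- rho)).
    rewrite rmorphN scaleNr opprK addrC; apply: pos_sc_add => //; rewrite /rho; lra.
  apply: (@pos_add_eq0 _ ((b - sc (- rho)) * q (- rho))).
  - exact/pos_sqr/pos_sa.
  - by apply: pos_mul => //; rewrite mulrBl mulrBr bq sc_comm.
  - by rewrite bE mulrBl pq0 sub0r subrr.
have p0 : p rho = 0.
  apply: sa_sqr_eq0; first exact: pos_sa.
  have pb : pos (sc rho - b) by apply: pos_sc_sub => //; rewrite /rho; lra.
  apply: (@pos_add_eq0 _ ((sc rho - b) * p rho)).
  - exact/pos_sqr/pos_sa.
  - by apply: pos_mul => //; rewrite mulrBl mulrBr bp sc_comm.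
  - by rewrite -[sc rho - b]opprB bE mulNr mulrBl qp0 subr0 subrr.
pose D := b * c - c * b.
have sD : star D = - D by rewrite /D starB !starM sb sc' opprB.
have main n : (0 < n)%N -> cnorm D ^+ 2 * n%:R <= 16 * rho ^+ 2 * cnorm c ^+ 2.
  move=> n0; have nR : 0 < n%:R :> R by rewrite ltr0n.
  pose d := 2 * rho / n%:R; pose t i := - rho + i%:R * d.
  have d0 : 0 <= d by rewrite divr_ge0 ?ltW // /rho; lra.
  have tmono i j : (i <= j)%N -> t i <= t j.
    by move=> ij; rewrite lerD2l ler_wpM2r // ler_nat.
  have tn : t n = rho by rewrite /t /d mulrC divfK ?gt_eqF //; lra.
  have t0 : t 0%N = - rho by rewrite /t mul0r addr0.
  pose g i := p (t i) - p (t i.+1).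
  pose g' i := q (t i.+1) - q (t i).
  have tS i : t i.+1 - t i = d by rewrite /t -natr1; ring.
  (* A slice and its complement [g' i] add up to the scalar [d], so [e i] is also a commutator with
     [g' i]. Using [g'] in one factor of [e i * e j] and [g] in the other leaves only terms
     containing some vanishing [g' x g] or [g x g']. *)
  have gE i : g i = sc d - g' i.
    by rewrite /g' -slice_compl tS opprB addrCA subrr addr0.
  pose e i := g i * c - c * g i.
  have eE i : e i = c * g' i - g' i * c.
    by rewrite /e gE mulrBl mulrBr sc_comm opprB [LHS]addrC subrKA.
  have ne i : cnorm (e i) <= 2 * d * cnorm c.
    have ng : cnorm (g i) <= d by rewrite -(tS i); apply: slice; exact: tmono.
    apply: (le_trans (cnormB _ _)).
    have := cnormM (g i) c; have := cnormM c (g i); have := cnorm_ge0 c; nra.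
  have gxg i j x : (i < j)%N -> g' i * x * g j = 0.
    move=> ij; rewrite /g /g' mulrBr !mulrBl !qxp ?subrr //; apply: tmono; lia.
  have gxg' i j x : (j < i)%N -> g i * x * g' j = 0.
    move=> ij; rewrite /g /g' mulrBr !mulrBl !pxq ?subrr //; apply: tmono; lia.
  have orth (u v : A) : (forall x, u * x * v = 0) -> (c * u - u * c) * (v * c - c * v) = 0.
    move=> uv; rewrite mulrBl !mulrBr !mulrA.
    have uv1 : u * v = 0 by rewrite -[u]mulr1.
    have ucv := uv c; have uccv := uv (c * c); rewrite mulrA in uccv.
    rewrite -(mulrA c u v) uv1 mulr0 mul0r -(mulrA c u) -(mulrA c (u * c)) ucv uccv.
    by rewrite !(mulr0, mul0r, subrr).
  have ee i j : i != j -> e i * e j = 0.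
    rewrite neq_ltn => /orP[ij|ji].
      by rewrite (eE i) /e orth // => x; exact: gxg.
    rewrite (eE j) /e.
    by rewrite -[X in X * _]opprB -[X in _ * X]opprB mulrNN orth // => x; exact: gxg'.
  have DE : D = \sum_(i < n) e i.
    rewrite sumrB -mulr_suml -mulr_sumr.
    (* The telescoping sum is [p (- rho)], which equals [b + rho] because [q (- rho) = 0]. *)
    have -> : \sum_(i < n) g i = b + sc rho.
      rewrite -(big_mkord xpredT g) /g.
      under eq_bigr do rewrite -opprB.
      rewrite sumrN telescope_sumr // opprB tn t0 p0 subr0.
      by rewrite -[p _]subr0 -{1}q0 -bE rmorphN scaleNr opprK.
    by rewrite mulrDl mulrDr sc_comm opprD addrACA subrr addr0.
  have DD : D * D = \sum_(i < n) e i * e i.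
    rewrite {1}DE mulr_suml; apply: eq_bigr => i _.
    rewrite DE mulr_sumr (bigD1 i) //= big1 ?addr0 // => j ji.
    by apply: ee; rewrite eq_sym.
  (* Only the [n] diagonal terms survive; with [d = 2 rho / n] their total is
     [16 rho^2 cnorm c ^+ 2 / n], which tends to 0. *)
  have : cnorm D ^+ 2 <= (2 * d * cnorm c) ^+ 2 *+ n.
    rewrite -cnorm_starM sD mulNr cnormN DD; apply: (le_trans (cnorm_sum _ _)).
    rewrite -[X in _ <= _ *+ X]card_ord -sumr_const; apply: ler_sum => i _.
    apply: (le_trans (cnormM _ _)); rewrite expr2; apply: ler_pM; rewrite ?cnorm_ge0 //.
  rewrite -mulr_natr => h.
  apply: (le_trans (ler_wpM2r (ltW nR) h)).
  by rewrite le_eqVlt; apply/orP; left; apply/eqP; rewrite /d; field; rewrite gt_eqF.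
apply/eqP; rewrite -subr_eq0 -/D; apply/eqP/cnorm_le0; rewrite leNgt; apply/negP => D0.
set K := 16 * _ * _ in main.
have D2 : 0 < cnorm D ^+ 2 by rewrite exprn_gt0.
have K0 : 0 <= K by rewrite mulr_ge0 ?sqr_ge0 // mulr_ge0 ?sqr_ge0.
have := archi_boundP (divr_ge0 K0 (ltW D2)) => /=; set n := Num.bound _ => hn.
have := main n.+1 (ltn0Sn n); rewrite leNgt => /negP; apply.
rewrite mulrC -ltr_pdivrMr //; apply: (lt_le_trans hn); rewrite ler_nat //.
Qed.

Lemma exists_sqr_eq0 : ~ (forall x y : A, x * y = y * x) ->
  exists x, x <> 0 /\ x * x = 0.
Proof.
move=> nc; apply: contrapT => H; apply: nc => x y.
have red z : z * z = 0 -> z = 0.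
  by move=> zz; apply: contrapT => z0; apply: H; exists z.
have cm := sa_commute_of_reduced red.
move: (re_part x) (im_part x) (re_im_partE x) (re_part_sa x) (im_part_sa x).
move=> a b -> sa sb.
move: (re_part y) (im_part y) (re_im_partE y) (re_part_sa y) (im_part_sa y).
move=> c d -> sc' sd.
rewrite !mulrDl !mulrDr -!scalerAl -!scalerAr.
rewrite (cm _ _ sa sc') (cm _ _ sa sd) (cm _ _ sb sc') (cm _ _ sb sd).
by rewrite addrACA.
Qed.

(** * The seminorm and numerical radius at [a] *)

Section Seminorm.
Context {a : A} (a_pos : pos a).
Implicit Types (f : A -> R[i]) (c M : R).

Lemma Re_ge0 (z : R[i]) : 0 <= z -> 0 <= complex.Re z.
Proof. by rewrite lecE => /andP[]. Qed.

Lemma normc_ge0 (z : R[i]) : 0 <= Normc.normc z.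
Proof. by case: z => u v; rewrite /= sqrtr_ge0. Qed.

Lemma normc_sqr (z : R[i]) :
  Normc.normc z ^+ 2 = complex.Re z ^+ 2 + complex.Im z ^+ 2.
Proof. by case: z => u v; rewrite /= sqr_sqrtr // addr_ge0 ?sqr_ge0. Qed.

Lemma normc_le_Re_Im (z : R[i]) (m : R) : Normc.normc z <= m ->
  [/\ complex.Re z <= m, - complex.Re z <= m,
      complex.Im z <= m & - complex.Im z <= m].
Proof. by have := normc_sqr z; have := normc_ge0 z; split; nra. Qed.

(** Trades quotients of states for the normalization [f a = 1]. In the converse [f 1] cannot vanish,
    since Cauchy-Schwarz would give [f a = 0]. *)
Lemma states_atP f : states_at a f <-> pos_functional f /\ f a = 1.
Proof.
split=> [[g [gs ga]] <-|[Hf fa]].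
  have Hg : pos_functional g by case: gs.
  split; last by rewrite divff.
  split=> [c x y|x]; first by rewrite (pfD Hg) (pfZ Hg) mulrDl mulrA.
  by rewrite divr_ge0 //; [exact: Hg.2|exact: pf_pos].
have f1 : f 1 != 0.
  apply/eqP => f1; have := pf_cauchy_schwarz Hf a 1.
  rewrite star1 !mul1r f1 fa mulr0 Normc.normc1 expr1n; lra.
have f1_ge0 : 0 <= f 1 by have := Hf.2 1; rewrite star1 mulr1.
exists (fun x => f x / f 1); last first.
  by apply/funext => x; rewrite fa div1r invrK mulrVK ?unitfE.
split; last by rewrite fa div1r invr_eq0.
split; last by rewrite divff.
  by move=> c x y; rewrite (pfD Hf) (pfZ Hf) mulrDl mulrA.
by move=> x; rewrite divr_ge0 //; exact: Hf.2.
Qed.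

Lemma a_sqrt : exists k, star k = k /\ k * k = a.
Proof. by have [k [[sk _] kk _]] := pos_sqrt a_pos; exists k. Qed.

Lemma a_sa : star a = a.
Proof. exact: pos_sa. Qed.

Lemma a_form_ge0 f x : pos_functional f -> 0 <= f (star x * a * x).
Proof.
move=> Hf; have [k [sk <-]] := a_sqrt.
by have := Hf.2 (k * x); rewrite starM sk !mulrA.
Qed.

Lemma a_form_cauchy_schwarz f x y : pos_functional f ->
  Normc.normc (f (star y * a * x)) ^+ 2 <=
  complex.Re (f (star x * a * x)) * complex.Re (f (star y * a * y)).
Proof.
move=> Hf; have [k [sk <-]] := a_sqrt.
by have := pf_cauchy_schwarz Hf (k * x) (k * y); rewrite !starM sk !mulrA.
Qed.

Lemma a_form_null f x y : pos_functional f -> f (star y * a * y) = 0 ->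
  f (star y * a * x) = 0.
Proof.
move=> Hf y0; have := a_form_cauchy_schwarz x y Hf; rewrite y0 mulr0 => h.
by apply: Normc.eq0_normc; apply/eqP; rewrite -sqrf_eq0 eq_le h sqr_ge0.
Qed.

Lemma states_at_conj f u : states_at a f -> f (star u * a * u) != 0 ->
  states_at a (fun z => f (star u * z * u) / f (star u * a * u)).
Proof.
move=> /states_atP[Hf fa] n0; apply/states_atP; split; last by rewrite divff.
split=> [c x y|x].
  by rewrite mulrDr mulrDl -scalerAr -scalerAl (pfD Hf) (pfZ Hf) mulrDl mulrA.
rewrite divr_ge0 ?a_form_ge0 //.
by have := Hf.2 (x * u); rewrite starM !mulrA.
Qed.

Lemma real_divE (z w : R[i]) : 0 <= w ->
  complex.Re (z / w) = complex.Re z / complex.Re w /\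
  Normc.normc (z / w) = Normc.normc z / complex.Re w.
Proof.
move=> w0; have wE : w = rc (complex.Re w) by rewrite RRe_real // ger0_real.
have re0 := Re_ge0 w0; rewrite {1 3}wE; move: re0; set t := complex.Re w => t0.
split.
  by rewrite -fmorphV; case: z => p q /=; rewrite mulr0 subr0.
by rewrite Normc.normcM Normc.normcV /= expr0n addr0 sqrtr_sqr ger0_norm.
Qed.

(** Homogeneous form of the bound, obtained by normalizing the conjugate of [f] by [u]; when that is
    impossible, both sides vanish by [a_form_null]. *)
Lemma num_radius_conj f u x c : states_at a f ->
  (forall g, states_at a g -> Normc.normc (g (a * x)) <= c) ->
  Normc.normc (f (star u * (a * x) * u)) <= c * complex.Re (f (star u * a * u)).
Proof.
move=> fS H; have [Hf _] := (states_atP f).1 fS.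
have [u0|un] := eqVneq (f (star u * a * u)) 0.
  by rewrite !mulrA -mulrA (a_form_null _ Hf u0) u0 mulr0 Normc.normc0.
have := H _ (states_at_conj fS un).
have r0 := a_form_ge0 u Hf; rewrite (real_divE _ r0).2 ler_pdivrMr //.
rewrite lt_def Re_ge0 // andbT; apply: contra un => /eqP e.
by rewrite -[f _]RRe_real ?ger0_real // e.
Qed.

(** Adjointability handles null vectors [u]: writing [star x * a] as [a * y] exposes a factor
    [star u * a], which [a_form_null] kills. *)
Lemma norm_at_conj f u x M : states_at a f -> adjointable a x ->
  (forall g, states_at a g -> complex.Re (g (star x * a * x)) <= M) ->
  complex.Re (f (star u * (star x * a * x) * u)) <= M * complex.Re (f (star u * a * u)).
Proof.
move=> fS [y yE] H; have [Hf _] := (states_atP f).1 fS.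
have [u0|un] := eqVneq (f (star u * a * u)) 0.
  by rewrite -yE !mulrA -(mulrA _ y) -(mulrA _ (y * x)) (a_form_null _ Hf u0) u0 mulr0.
have := H _ (states_at_conj fS un).
have r0 := a_form_ge0 u Hf; rewrite (real_divE _ r0).1 ler_pdivrMr //.
rewrite lt_def Re_ge0 // andbT; apply: contra un => /eqP e.
by rewrite -[f _]RRe_real ?ger0_real // e.
Qed.

Lemma conj_expand f (z w : R[i]) x y : pos_functional f ->
  f (star (z *: 1 + w *: x) * y * (z *: 1 + w *: x)) =
  Num.conj z * z * f y + Num.conj z * w * f (y * x) +
  (Num.conj w * z * f (star x * y) + Num.conj w * w * f (star x * y * x)).
Proof.
move=> Hf; rewrite starD !starZ star1 !mulrDl !mulrDr -!scalerAl !mul1r -!scalerAr !mulr1.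
by rewrite !(pfD Hf) !(pfZ Hf) -!mulrA addrACA -[in RHS]addrACA [in RHS]addrACA.
Qed.

Lemma a_form_real f x : pos_functional f ->
  f (star x * a * x) = rc (complex.Re (f (star x * a * x))).
Proof. by move=> Hf; rewrite RRe_real // ger0_real // a_form_ge0. Qed.

(* Polarization: [t (f (x^* a x))] is a combination of the values of
   [u |-> f (u^* a x u)] at [u = 1 + i^k t x]. *)
Lemma norm_le_twice_num_radius x c : 0 < c ->
  (forall g, states_at a g -> Normc.normc (g (a * x)) <= c) ->
  forall f, states_at a f -> complex.Re (f (star x * a * x)) <= (2 * c) ^+ 2.
Proof.
move=> c0 H f fS; have [Hf fa] := (states_atP f).1 fS.
set p := complex.Re _; have p0 : 0 <= p by exact/Re_ge0/a_form_ge0.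
(* This [t] maximizes [t - c t^2], hence gives the best bound from [4 t p <= c (4 + 4 t^2 p)]. *)
pose t : R := (2 * c)^-1.
have t0 : 0 < t by rewrite invr_gt0 mulr_gt0.
have ct : c * t = 2^-1 by rewrite /t; field; rewrite gt_eqF.
have K w := num_radius_conj (1 *: 1 + w *: x) fS H.
have xa : f (star x * a) = Num.conj (f (a * x)).
  by rewrite -(pf_star Hf) starM a_sa.
have pE : f (star x * a * x) = rc p by exact: a_form_real.
have N w := conj_expand 1 w x a Hf; have Q w := conj_expand 1 w x (a * x) Hf.
have := K (rc t); have := K (rc (- t)); have := K ('i%C * rc t); have := K ('i%C * rc (- t)).
rewrite !N !Q !mulrA fa xa pE.
case: (f (a * x)) => a1 a2; case: (f (a * x * x)) => b1 b2.
case: (f (star x * a * x * x)) => d1 d2.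
(* The signed coordinate of each value is chosen so that all other terms cancel in the sum and
   [4 t p] remains. *)
move=> /normc_le_Re_Im[_ _ h1 _] /normc_le_Re_Im[_ _ _ h2].
move=> /normc_le_Re_Im[_ h3 _ _] /normc_le_Re_Im[h4 _ _ _].
move: h1 h2 h3 h4 => /= => h1 h2 h3 h4.
have E : 4 * t * p <= c * (4 + 4 * t ^+ 2 * p) by lra.
move: E {h1 h2 h3 h4} => E.
have E2 : c * (4 + 4 * t ^+ 2 * p) = 4 * c + 2 * (t * p).
  rewrite (_ : c * _ = 4 * c + 4 * (c * t) * (t * p)); last by ring.
  by rewrite ct; congr (_ + _); field.
have E3 : 2 * (t * p) <= 4 * c by rewrite E2 in E; lra.
have : c * (2 * (t * p)) <= c * (4 * c) by rewrite ler_pM2l.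
have -> : c * (2 * (t * p)) = 2 * (c * t) * p by ring.
by rewrite ct; lra.
Qed.

(* Pearcy's identity: the nonnegative numbers [Re f (v^* a (c - x) v)] at
   [v = c + x] and [Re f (v^* a (c + x) v)] at [v = c - x] add up to
   [2 c Re f (a (c^2 - x^2))]. *)
Lemma Re_num_sqr x c : 0 < c ->
  (forall g, states_at a g -> Normc.normc (g (a * x)) <= c) ->
  forall f, states_at a f -> complex.Re (f (a * (x * x))) <= c ^+ 2.
Proof.
move=> c0 H f fS; have [Hf fa] := (states_atP f).1 fS.
have K w := num_radius_conj (rc c *: 1 + w *: x) fS H.
have xa : f (star x * a) = Num.conj (f (a * x)).
  by rewrite -(pf_star Hf) starM a_sa.
have pE := a_form_real x Hf.
set p := complex.Re _ in pE.
have N w := conj_expand (rc c) w x a Hf; have Q w := conj_expand (rc c) w x (a * x) Hf.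
have := K 1; have := K (- 1).
rewrite !N !Q !mulrA fa xa pE.
case: (f (a * x)) => a1 a2; case: (f (a * x * x)) => b1 b2.
case: (f (star x * a * x * x)) => d1 d2.
move=> /normc_le_Re_Im[_ h1 _ _] /normc_le_Re_Im[h2 _ _ _].
move: h1 h2 => /= h1 h2.
have : c * b1 <= c * c ^+ 2 by lra.
by rewrite ler_pM2l.
Qed.

Lemma num_radius_sqr x c : 0 < c ->
  (forall g, states_at a g -> Normc.normc (g (a * x)) <= c) ->
  forall f, states_at a f -> Normc.normc (f (a * (x * x))) <= c ^+ 2.
Proof.
move=> c0 H f fS; have [Hf _] := (states_atP f).1 fS.
have [b0|bn] := eqVneq (f (a * (x * x))) 0; first by rewrite b0 Normc.normc0 sqr_ge0.
set b := f _ in bn *.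
(* Rotating [x] by a square root [z] of [w] makes [f (a * (x * x))] real and nonnegative without
   affecting the hypothesis. *)
pose w : R[i] := `|b| / b; pose z := sqrtC w.
have zw : z * z = w by rewrite -expr2 sqrtCK.
have nw : `|w| = 1 by rewrite normf_div normr_id divff // normr_eq0.
have nz : `|z| = 1.
  by apply/eqP; rewrite -(eqrXn2 (n := 2)) // expr1n -normrX expr2 zw nw.
have nzR : Normc.normc z = 1 by have := congr1 (@complex.Re R) nz.
have : complex.Re (f (a * ((z *: x) * (z *: x)))) <= c ^+ 2.
  apply: Re_num_sqr => // g gS; have [Hg _] := (states_atP g).1 gS.
  by rewrite -scalerAr (pfZ Hg) Normc.normcM nzR mul1r; exact: H.
rewrite -!scalerAl -!scalerAr !(pfZ Hf) mulrA zw -/b.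
by rewrite mulrVK ?unitfE.
Qed.

Lemma num_radius_nilpotent x M : adjointable a x -> a * (x * x) = 0 ->
  (forall g, states_at a g -> complex.Re (g (star x * a * x)) <= M) ->
  forall f, states_at a f -> 4 * Normc.normc (f (a * x)) ^+ 2 <= M.
Proof.
move=> xadj x2 H f fS; have [Hf fa] := (states_atP f).1 fS.
have pE := a_form_real x Hf; have := H f fS; set p := complex.Re _ in pE * => pM.
have p0 : 0 <= p by exact/Re_ge0/a_form_ge0.
have xa : f (star x * a) = Num.conj (f (a * x)).
  by rewrite -(pf_star Hf) starM a_sa.
have CS : Normc.normc (f (a * x)) ^+ 2 <= p.
  by have := a_form_cauchy_schwarz x 1 Hf; rewrite star1 !mul1r mulr1 fa /= mulr1.
have [p00|pn] := eqVneq p 0.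
  by rewrite p00 in CS pM; have := sqr_ge0 (Normc.normc (f (a * x))); lra.
have pgt : 0 < p by rewrite lt_def pn.
have x2' : star x * star x * a = 0 by rewrite -starM -{1}a_sa -starM x2 star0.
have := fun w => norm_at_conj (1 *: 1 + w *: x) fS xadj H.
move: CS; rewrite normc_sqr.
have E1 w := conj_expand 1 w x (star x * a * x) Hf.
have E2 w := conj_expand 1 w x a Hf.
have z1 : star x * a * x * x = 0 by rewrite -!mulrA x2 mulr0.
have z2 : star x * (star x * a * x) = 0 by rewrite !mulrA x2' mul0r.
move=> CS; set al := f (a * x) in CS *.
pose t := p^-1.
(* This is [- conj al / p], the minimizer of [f (star u * a * u)] over [u = 1 + w x]; its minimum is
   [1 - n / p], while [f (star u * (star x * a * x) * u)] stays equal to [p]. *)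
move=> /(_ (Complex (- t * complex.Re al) (t * complex.Im al))).
rewrite E1 E2 z1 z2 mul0r !(pf0 Hf) fa xa pE -/al.
case: al CS => a1 a2 /= CS.
set n := a1 ^+ 2 + a2 ^+ 2 in CS *.
move=> h.
have h2 : p <= M * (1 - 2 * (t * n) + t ^+ 2 * n * p) by rewrite /n; lra.
have tp : t * p = 1 by rewrite mulVf.
have h3 : p <= M * (1 - t * n).
  apply: (le_trans h2); rewrite (_ : t ^+ 2 * n * p = (t * p) * (t * n)); last by ring.
  by rewrite tp; lra.
have h4 : p * p <= M * (p - n).
  have -> : M * (p - n) = (M * (1 - t * n)) * p.
    have -> : M * (1 - t * n) * p = M * (p - (t * p) * n) by ring.
    by rewrite tp mul1r.
  by rewrite ler_pM2r.
have M0 : 0 < M by apply: lt_le_trans pM.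
(* Combine [p^2 <= M (p - n)] with [(M - 2 p)^2 >= 0]. *)
have : M * (4 * n) <= M * M.
  by move: h4 (sqr_ge0 (M - 2 * p)) {h h2 h3 CS E1 E2} => h4 h5; lra.
by rewrite ler_pM2l.
Qed.

Lemma adjointable_sym x y : a * y = star x * a -> a * x = star y * a.
Proof. by move=> yE; rewrite -[LHS]starK starM a_sa -yE starM a_sa. Qed.

Lemma adjoint_expr x y n : a * y = star x * a -> a * y ^+ n = star (x ^+ n) * a.
Proof.
move=> yE; elim: n => [|n IH]; first by rewrite !expr0 star1 mulr1 mul1r.
by rewrite exprSr mulrA IH -mulrA yE mulrA !starX -exprSr.
Qed.

Lemma adjointableZ r x : adjointable a x -> adjointable a (rc r *: x).
Proof. by move=> [y e]; exists (rc r *: y); rewrite -scalerAr e starZr scalerAl. Qed.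

Lemma adjointable1 : adjointable a 1.
Proof. by exists 1; rewrite star1 mulr1 mul1r. Qed.

(** At the vector 1, Cauchy-Schwarz bounds [f (a * (y * x))] by the seminorm of [y * x], which by
    commutation equals that of [x * x]. *)
Lemma norm_at_sqr f x y : states_at a f -> a * y = star x * a -> y * x = x * y ->
  complex.Re (f (star x * a * x)) ^+ 2 <= complex.Re (f (star (x * x) * a * (x * x))).
Proof.
move=> fS yE yx; have [Hf fa] := (states_atP f).1 fS.
have := a_form_cauchy_schwarz (y * x) 1 Hf.
rewrite star1 !mul1r mulr1 fa /= mulr1 mulrA yE.
have -> : star (y * x) * a * (y * x) = star (x * x) * a * (x * x).
  rewrite !starM -(mulrA (star x) (star y)) -(adjointable_sym yE) -!mulrA.
  congr (_ * _); rewrite (mulrA x y) -yx !mulrA yE -!mulrA //.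
apply: le_trans; rewrite normc_sqr lerDl sqr_ge0 //.
Qed.

Lemma norm_at_le_num_radius x y c : a * y = star x * a -> y * x = x * y ->
  (forall g, states_at a g -> Normc.normc (g (a * x)) <= c) -> 0 < c ->
  forall f, states_at a f -> complex.Re (f (star x * a * x)) <= c ^+ 2.
Proof.
move=> yE yx H c0 f fS; have [Hf fa] := (states_atP f).1 fS.
set p := complex.Re _; have p0 : 0 <= p by exact/Re_ge0/a_form_ge0.
have X2 k (z : A) : z ^+ (2 ^ k.+1) = z ^+ (2 ^ k) * z ^+ (2 ^ k).
  by rewrite expnS mul2n -addnn exprD.
have c0k n : 0 < c ^+ n by rewrite exprn_gt0.
have num k : forall g, states_at a g -> Normc.normc (g (a * x ^+ (2 ^ k))) <= c ^+ (2 ^ k).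
  elim: k => [|k IH] g gS; first by rewrite !expr1; exact: H.
  rewrite X2 expnS mulnC exprM; exact: num_radius_sqr.
have adj n := adjoint_expr n yE.
have com n : y ^+ n * x ^+ n = x ^+ n * y ^+ n.
  by apply: commrX; apply: commr_sym; apply: commrX; apply: esym.
have nrm k : p ^+ (2 ^ k) <= complex.Re (f (star (x ^+ (2 ^ k)) * a * x ^+ (2 ^ k))).
  elim: k => [|k IH]; first by rewrite expr1.
  rewrite X2 expnS mulnC exprM.
  apply: le_trans (norm_at_sqr fS (adj _) (com _)).
  by rewrite ler_pXn2r ?nnegrE // ?exprn_ge0 // Re_ge0 // a_form_ge0.
(* The 4 is the square of the polarization factor 2, incurred once, at the power [2 ^ k]. *)
apply: (@ler_of_pow2_growth _ _ _ 4) => // [|k]; first exact: sqr_ge0.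
apply: (le_trans (nrm k)).
have := norm_le_twice_num_radius (c0k _) (num k) fS.
by rewrite exprMn -exprM mulnC exprM; lra.
Qed.

(** [z = y * x] satisfies [a * z = star z * a], so Cauchy-Schwarz against 1 squares its exponent
    repeatedly: [p ^+ (2 ^ k)] is at most [f (1) cnorm a cnorm z ^+ (2 ^ k)]. The prefactor depends
    on [f], but the growth rate [cnorm z] does not. *)
Lemma norm_at_bounded x : adjointable a x ->
  exists2 M, 0 <= M & forall f, states_at a f -> complex.Re (f (star x * a * x)) <= M.
Proof.
move=> [y yE]; pose z := y * x; exists (cnorm z); first exact: cnorm_ge0.
have az : a * z = star z * a by rewrite starM -mulrA -(adjointable_sym yE) !mulrA yE.
have azX n := adjoint_expr n az.
move=> f fS; have [Hf fa] := (states_atP f).1 fS.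
set p := complex.Re _; have p0 : 0 <= p by exact/Re_ge0/a_form_ge0.
have X2 k : z ^+ (2 ^ k.+1) = z ^+ (2 ^ k) * z ^+ (2 ^ k).
  by rewrite expnS mul2n -addnn exprD.
have grow k : p ^+ (2 ^ k) <= Normc.normc (f (a * z ^+ (2 ^ k))).
  elim: k => [|k IH].
    rewrite !expr1 /p -yE -mulrA.
    by have [] := normc_le_Re_Im (lexx (Normc.normc (f (a * z)))).
  rewrite expnS mulnC exprM.
  apply: (@le_trans _ _ (Normc.normc (f (a * z ^+ (2 ^ k))) ^+ 2)).
    by rewrite ler_pXn2r ?nnegrE ?exprn_ge0 ?normc_ge0.
  have := a_form_cauchy_schwarz (z ^+ (2 ^ k)) 1 Hf.
  rewrite star1 !mul1r mulr1 fa /= mulr1 -azX -mulrA -X2 mulnC -expnS => h.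
  apply: (le_trans h).
  by have [] := normc_le_Re_Im (lexx (Normc.normc (f (a * z ^+ (2 ^ k.+1))))).
apply: (@ler_of_pow2_growth _ _ _ (complex.Re (f 1) * cnorm a)) => // [|k].
  exact: cnorm_ge0.
apply: (le_trans (grow k)); apply: (le_trans (pf_bounded Hf _)).
have f1 : 0 <= complex.Re (f 1) by have := Hf.2 1; rewrite star1 mulr1 => /Re_ge0.
rewrite -mulrA ler_wpM2l //; apply: (le_trans (cnormM _ _)).
by rewrite ler_wpM2l ?cnorm_ge0 // cnormX.
Qed.

(** Some state [g] is nonzero at [star x * a * x], since [sqrt a * x] is nonzero. Adjointability
    rewrites this element as [a * y * x], so [g a = 0] would contradict Cauchy-Schwarz. *)
Lemma exists_state_at x : adjointable a x -> a * x <> 0 ->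
  exists2 f, states_at a f & 0 < complex.Re (f (star x * a * x)).
Proof.
move=> [y yE] ax; have [k [sk kk]] := a_sqrt.
have zz : star (k * x) * (k * x) = star x * a * x by rewrite starM sk -kk !mulrA.
have [g gs gn] : exists2 g, states A g & g (star (k * x) * (k * x)) <> 0.
  apply: exists_state_neq0; first by rewrite starM starK.
  by move=> /star_sqr_eq0 kx; apply: ax; rewrite -kk -mulrA kx mulr0.
rewrite zz in gn.
have Hg : pos_functional g by case: gs.
have ga : g a != 0.
  apply/eqP => ga; apply: gn; rewrite -yE -mulrA -[a]mul1r -star1.
  by apply: a_form_null => //; rewrite star1 mul1r mulr1.
exists (fun z => g z / g a); first by exists g.
have ga0 : 0 <= g a by exact: pf_pos.
rewrite (real_divE _ ga0).1; apply: divr_gt0.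
  rewrite lt_def Re_ge0 ?a_form_ge0 // andbT; apply/eqP => e.
  by apply: gn; rewrite a_form_real // e.
rewrite lt_def Re_ge0 // andbT; apply: contra ga => /eqP e.
by rewrite -[g a]RRe_real ?ger0_real // e.
Qed.

(** * Bounds on the numerical index *)

Lemma norm_at_leP x (N : R) : 0 <= N ->
  (norm_at a x <= N%:E)%E <->
  (forall f, states_at a f -> complex.Re (f (star x * a * x)) <= N ^+ 2).
Proof.
move=> N0; split=> [/ereal_supP H f fS|H].
  have [Hf _] := (states_atP f).1 fS.
  have := H (Num.sqrt (complex.Re (f (star x * a * x))))%:E; rewrite lee_fin => h.
  have /h {}h : [set (Num.sqrt (complex.Re (f (star x * a * x))))%:E
            | f in states_at a]%classic (Num.sqrt (complex.Re (f (star x * a * x))))%:E.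
    by exists f.
  rewrite -[X in X <= _]sqr_sqrtr ?Re_ge0 ?a_form_ge0 //.
  by rewrite ler_pXn2r ?nnegrE ?sqrtr_ge0.
apply: ge_ereal_sup => _ [f fS <-]; rewrite lee_fin.
have [Hf _] := (states_atP f).1 fS.
rewrite -(ler_pXn2r (n := 2)) ?nnegrE ?sqrtr_ge0 // sqr_sqrtr ?H //.
by rewrite Re_ge0 // a_form_ge0.
Qed.

Lemma num_radius_at_leP x (c : R) :
  (num_radius_at a x <= c%:E)%E <->
  (forall f, states_at a f -> Normc.normc (f (a * x)) <= c).
Proof.
split=> [/ereal_supP H f fS|H].
  by rewrite -lee_fin; apply: H; exists f.
by apply: ge_ereal_sup => _ [f fS <-]; rewrite lee_fin H.
Qed.

(** Supplies the strictly positive real bound that the estimates above expect, even when [e] is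
    nonpositive or [-oo]. *)
Lemma ereal_lt_fin_bound (e : \bar R) (b : R) : 0 < b -> (e < b%:E)%E ->
  exists c, [/\ 0 < c, c < b & (e <= c%:E)%E].
Proof.
move=> b0; case: e => [r| |] //.
  rewrite lte_fin => rb; exists (Num.max r (b / 2)); split.
  - by rewrite lt_max; apply/orP; right; rewrite divr_gt0.
  - by rewrite gt_max rb; lra.
  - by rewrite lee_fin le_max lexx.
by move=> _; exists (b / 2); split; rewrite ?leNye //; lra.
Qed.

Lemma num_index_ge (b : R) : 0 < b ->
  (forall x c, adjointable a x -> 0 < c ->
    (forall f, states_at a f -> Normc.normc (f (a * x)) <= c) ->
    forall f, states_at a f -> complex.Re (f (star x * a * x)) <= (c / b) ^+ 2) ->
  (b%:E <= num_index_at a)%E.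
Proof.
move=> b0 H; apply: le_ereal_inf_tmp => _ [x [xadj x1] <-].
rewrite leNgt; apply/negP => /(ereal_lt_fin_bound b0)[c [c0 cb /num_radius_at_leP vc]].
have cb0 : 0 <= c / b by rewrite divr_ge0 ?ltW.
have := (norm_at_leP x cb0).2 (H x c xadj c0 vc).
by rewrite x1 lee_fin ler_pdivlMr // mul1r leNgt cb.
Qed.

Lemma num_index_ge_half : ((2^-1)%:E <= num_index_at a)%E.
Proof.
apply: num_index_ge => [|x c _ c0 vc f fS]; first by rewrite invr_gt0.
by rewrite invrK mulrC; exact: norm_le_twice_num_radius.
Qed.

Lemma num_index_ge_one :
  (forall x y, adjointable a x -> adjointable a y -> x * y = y * x) ->
  (1 <= num_index_at a)%E.
Proof.
move=> com; apply: num_index_ge => // x c [y yE] c0 vc f fS.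
rewrite divr1; apply: (@norm_at_le_num_radius x y) => //.
by apply: com; [exists x; exact: adjointable_sym|exists y].
Qed.

Lemma num_index_le_one : a <> 0 -> (num_index_at a <= 1)%E.
Proof.
move=> a0; apply: ge_ereal_inf; exists (num_radius_at a 1).
  exists 1 => //; split; first exact: adjointable1.
  have [|f fS _] := exists_state_at adjointable1; first by rewrite mulr1.
  apply/eqP; rewrite eq_le; apply/andP; split.
    apply/(norm_at_leP 1 ler01) => g /states_atP[_ ga].
    by rewrite star1 mul1r mulr1 ga expr1n.
  apply: ereal_sup_ubound; exists f => //.
  by have [_ fa] := (states_atP f).1 fS; rewrite star1 mul1r mulr1 fa sqrtr1.
apply/num_radius_at_leP => f /states_atP[_ fa].
by rewrite mulr1 fa Normc.normc1.
Qed.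

Lemma num_index_le_half x : adjointable a x -> a * x <> 0 -> a * (x * x) = 0 ->
  (num_index_at a <= (2^-1)%:E)%E.
Proof.
move=> xadj ax ax2.
have [M M0 HM] := norm_at_bounded xadj.
have [f0 f0S f0x] := exists_state_at xadj ax.
(* Adjointability makes the seminorm finite from above; the state [f0] excludes [-oo] and shows
   below that [N] is positive. *)
have [N NE] : exists N, norm_at a x = N%:E.
  have le : (norm_at a x <= (Num.sqrt M)%:E)%E.
    apply/norm_at_leP; first exact: sqrtr_ge0.
    by move=> f fS; rewrite sqr_sqrtr //; exact: HM.
  have ge : ((Num.sqrt (complex.Re (f0 (star x * a * x))))%:E <= norm_at a x)%E.
    by apply: ereal_sup_ubound; exists f0.
  move: le ge; case: (norm_at a x) => [N| |] //; by exists N.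
have N0 : 0 < N.
  rewrite -lte_fin -NE; apply: (@lt_le_trans _ _ (Num.sqrt (complex.Re (f0 (star x * a * x))))%:E).
    by rewrite lte_fin sqrtr_gt0.
  by apply: ereal_sup_ubound; exists f0.
pose x' := rc N^-1 *: x.
have x'E f : states_at a f -> complex.Re (f (star x' * a * x')) =
    N^-1 ^+ 2 * complex.Re (f (star x * a * x)).
  move=> /states_atP[Hf _]; rewrite starZr -!scalerAl -!scalerAr !(pfZ Hf).
  by rewrite (a_form_real x Hf) -!rmorphM /=; ring.
have x'adj : adjointable a x' by exact: adjointableZ.
have x'1 : norm_at a x' = 1%:E.
  apply/eqP; rewrite eq_le; apply/andP; split.
    apply/(norm_at_leP _ ler01) => f fS; rewrite x'E // exprVn expr1n.
    rewrite ler_pdivrMl ?exprn_gt0 // mulr1.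
    by apply: (norm_at_leP x (ltW N0)).1 => //; rewrite NE.
  (* A bound [c < 1] for [x'] would scale back to the bound [c N < N] for [x]. *)
  rewrite leNgt; apply/negP => /(ereal_lt_fin_bound ltr01)[c [c0 c1 le]].
  have : (norm_at a x <= (c * N)%:E)%E.
    apply/norm_at_leP; first by rewrite mulr_ge0 // ltW.
    move=> f fS; have := (norm_at_leP x' (ltW c0)).1 le f fS.
    by rewrite x'E // exprVn ler_pdivrMl ?exprn_gt0 // exprMn mulrC.
  by rewrite NE lee_fin leNgt -[X in _ < X]mul1r ltr_pM2r // c1.
apply: ge_ereal_inf; exists (num_radius_at a x'); first by exists x'.
apply/num_radius_at_leP => f fS.
have ax'2 : a * (x' * x') = 0.
  by rewrite -scalerAl -!scalerAr ax2 !scaler0.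
have := num_radius_nilpotent x'adj ax'2 _ fS => /(_ 1).
have := (norm_at_leP x' ler01).1; rewrite x'1 expr1n => /(_ (lexx _)) H /(_ H).
by have := normc_ge0 (f (a * x')); nra.
Qed.

End Seminorm.

End Basics.

Theorem theorem4p8 (R : realType) (A : cstarAlgType R) (a : A)
    (a_neq0 : a <> 0) (a_pos : is_positive a) :
  [/\ (forall x y : A, adjointable a x -> adjointable a y -> x * y = y * x) ->
        num_index_at a = 1%:E,
      ~ (forall x y : A, x * y = y * x) -> invertible a ->
        num_index_at a = (2^-1)%:E
    & (exists x : A, [/\ adjointable a x, a * x <> 0 & a * x ^+ 2 = 0]) ->
        num_index_at a = (2^-1)%:E].
Proof.
have pa := pos_of_is_positive a_pos.
have half (x : A) : adjointable a x -> a * x <> 0 -> a * (x * x) = 0 ->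
    num_index_at a = (2^-1)%:E.
  move=> xadj ax ax2; apply/eqP; rewrite eq_le num_index_ge_half // andbT.
  exact: num_index_le_half ax2.
split=> [com|nc [b [ab ba]]|[x [xadj ax ax2]]].
- by apply/eqP; rewrite eq_le num_index_le_one // num_index_ge_one.
- have [x [x0 xx]] := exists_sqr_eq0 nc.
  apply: (half x); last by rewrite xx mulr0.
    (* Multiplying by the inverse [b] of [a] solves the adjoint equation for any [x]. *)
    by exists (b * (star x * a)); rewrite mulrA ab mul1r.
  by move=> ax; apply: x0; rewrite -[x]mul1r -ba -mulrA ax mulr0.
- by apply: (half x) => //; rewrite -expr2.
Qed.
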